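(* Let $H,N,k\ge2$ be integers, let $m_j>0$ for $j=1,\dots,H$, let $\widetilde m_i>0$ and $c_i\colon\mathbb{R}\to\mathbb{R}^k$ be continuous for $i=1,\dots,N$, and set $\widetilde m=\sum_{i=1}^N\widetilde m_i$. Assume that there exists $\Xi>0$ such that $$\sup_{t\in\mathbb{R}}\|c_i(t)\|<\Xi\quad\text{for every } i=1,\dots,N.$$ Let $d=kH$ and, for $x=(q_1,\dots,q_H)\in\Sigma=\{(q_1,\dots,q_H)\in\mathbb{R}^{kH}: q_j\ne0,\ q_l\ne q_j\text{ for }l\ne j\}$, let $$U(x)=\widetilde m\sum_{j=1}^H\frac{m_j}{\|q_j\|}+\sum_{l<j}\frac{m_lm_j}{\|q_l-q_j\|}.$$ Let $\xi^+\in\mathcal{E}\cap\Sigma$ be a central configuration for $U$ satisfying the condition $$(\mathrm{BS})\qquad\nu_1>-\frac18\,\mathcal{U}(\xi^+),$$ where $\nu_1$ is the smallest eigenvalue of $\nabla^2\mathcal{U}(\xi^+)$. Let $\eta\in\mathopen]0,1\mathclose[$ be such that $\{x\in\mathbb{R}^{kH}\setminus\{0\}:\langle x,\xi^+\rangle\ge\eta|x|\}\subseteq\Sigma$. Then there exist $R'>\Xi+1$ and $\eta'\in[\eta,1[$ such that, for every $x_0\in\mathcal{T}(\xi^+,R',\eta')$, there exists a parabolic solution $x=(q_1,\dots,q_H)\colon[0,+\infty[\to\mathbb{R}^d$ of $$m_j\ddot q_j=-\sum_{i=1}^N\frac{\widetilde m_im_j(q_j-c_i(t))}{\|q_j-c_i(t)\|^3}-\sum_{l\ne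 j}\frac{m_lm_j(q_j-q_l)}{\|q_j-q_l\|^3},\qquad j=1,\dots,H,$$ satisfying $x(0)=x_0$ and $$\lim_{t\to+\infty}\frac{x(t)}{|x(t)|}=\xi^+.$$ Moreover, $|x(t)|\sim\omega t^{\frac23}$ for $t\to+\infty$, where $\omega=\sqrt[3]{9U(\xi^+)/2}$.
   Context: $\|\cdot\|$ denotes the Euclidean norm. On $\mathbb{R}^d=\mathbb{R}^{kH}$ the mass scalar product is $\langle x,y\rangle=\sum_{j=1}^Hm_j\,x_j\cdot y_j$ for $x=(x_1,\dots,x_H)$, $y=(y_1,\dots,y_H)$ with $x_j,y_j\in\mathbb{R}^k$ (dot denoting the Euclidean scalar product of $\mathbb{R}^k$), and $|x|=\sqrt{\langle x,x\rangle}$. $\mathcal{E}=\{x\in\mathbb{R}^d:|x|=1\}$ and $\mathcal{U}=U|_{\mathcal{E}}$ (defined on $\mathcal{E}\cap\Sigma$). A (normalized) central configuration is a critical point $\xi^+\in\mathcal{E}\cap\Sigma$ of $\mathcal{U}$. $\nabla^2\mathcal{U}(\xi^+)$ is the Hessian of $\mathcal{U}$ at the critical point $\xi^+$ with respect to the metric induced by $\langle\cdot,\cdot\rangle$, a self-adjoint operator on the tangent space $\mathcal{T}_{\xi^+}\mathcal{E}=\{v:\langle v,\xi^+\rangle=0\}$. For $R>0$ and $\eta\in\mathopen]0,1\mathclose[$, $\mathcal{T}(\xi^+,R,\eta)=\{x\in\mathbb{R}^d:|x|>R\text{ and }\langle x/|x|,\xi^+\rangle>\eta\}$. A solution $x\colon[0,+\infty[\to\mathbb{R}^d$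 (a $\mathcal{C}^2$ function avoiding the singularities of the equation) is called parabolic if $\lim_{t\to+\infty}|x(t)|=+\infty$ and $\lim_{t\to+\infty}\dot x(t)=0$. The notation $f(t)\sim g(t)$ means $f(t)/g(t)\to1$. *)

(* Defs.v *)
From HB Require Import structures.
From mathcomp Require Import all_boot all_order all_algebra.
From mathcomp Require Import all_classical all_reals all_analysis.
Set Implicit Arguments.
Unset Strict Implicit.
Unset Printing Implicit Defensive.
Import Order.TTheory GRing.Theory Num.Theory.
Import numFieldNormedType.Exports.
Local Open Scope classical_set_scope.
Local Open Scope ring_scope.

(* A configuration x = (q_1, ..., q_H) of R^(kH) is an H x k matrix, the body
   q_j being [row j x].  The library norm of a matrix is the sup norm; it is
   used only for the topology, hence the explicit norms [enorm] and [mnorm]. *)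

Section Euclidean.
Context {R : realType} {k : nat}.

Definition dotv (u v : 'rV[R]_k) : R := \sum_i u 0 i * v 0 i.

Definition enorm (u : 'rV[R]_k) : R := Num.sqrt (dotv u u).

End Euclidean.

Section Configurations.
Context {R : realType} {H k : nat}.
Implicit Types (m : 'I_H -> R) (x y xi v : 'M[R]_(H, k)).

Definition mdot m x y : R := \sum_j m j * dotv (row j x) (row j y).

Definition mnorm m x : R := Num.sqrt (mdot m x x).

Definition msphere m : set 'M[R]_(H, k) := [set x | mnorm m x = 1].

Definition Sigma : set 'M[R]_(H, k) :=
  [set x | (forall j, row j x != 0) /\
           (forall l j, l != j -> row l x != row j x)].

Definition potential (mt : R) m x : R :=
  mt * (\sum_j m j / enorm (row j x)) +
  \sum_(j < H) \sum_(l < H | (l < j)%N) m l * m j / enorm (row l x - row j x).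

Definition tangent m xi : set 'M[R]_(H, k) := [set v | mdot m v xi = 0].

Definition tangent_proj m x v : 'M[R]_(H, k) := v - mdot m v x *: x.

(* Gradient for the mass scalar product: <mgrad m f x, v> = df(x)[v]. *)
Definition mgrad m (f : 'M[R]_(H, k) -> R) x : 'M[R]_(H, k) :=
  \matrix_(j, i) ((m j)^-1 * 'D_(delta_mx j i) f x).

(* On the unit sphere, this is the Riemannian gradient of the restriction of
   f to the sphere with the metric induced by the mass scalar product. *)
Definition sphere_grad m (f : 'M[R]_(H, k) -> R) x : 'M[R]_(H, k) :=
  tangent_proj m x (mgrad m f x).

(* The Riemannian Hessian v |-> nabla_v grad of the restriction of f to the
   sphere.  The Levi-Civita connection of the sphere is the tangential part of
   the ambient derivative, which for tangent v depends only on the values on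
   the sphere of the differentiated field. *)
Definition sphere_hess m (f : 'M[R]_(H, k) -> R) xi v : 'M[R]_(H, k) :=
  tangent_proj m xi ('D_v (sphere_grad m f) xi).

Definition sphere_hess_eigenvalue m (f : 'M[R]_(H, k) -> R) xi (nu : R) : Prop :=
  exists v, [/\ v != 0, tangent m xi v & sphere_hess m f xi v = nu *: v].

Definition smallest_hess_eigenvalue m (f : 'M[R]_(H, k) -> R) xi (nu : R) :
    Prop :=
  sphere_hess_eigenvalue m f xi nu /\
  (forall mu, sphere_hess_eigenvalue m f xi mu -> nu <= mu).

Definition central_configuration (mt : R) m xi : Prop :=
  [/\ msphere m xi, Sigma xi &
      forall v, tangent m xi v -> 'D_v (potential mt m) xi = 0].

Definition cone m xi (rho eta : R) : set 'M[R]_(H, k) :=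
  [set x | rho < mnorm m x /\ eta < mdot m ((mnorm m x)^-1 *: x) xi].

(* dx is the derivative of x relatively to the half-line [0, +oo[; at 0 it is
   the one-sided derivative. *)
Definition halfline_derivative (x dx : R -> 'M[R]_(H, k)) : Prop :=
  forall t, 0 <= t ->
    (s - t)^-1 *: (x s - x t) @[s --> within `[0, +oo[ t^'] --> dx t.

(* x is of class C^2 on [0, +oo[, with first and second derivatives dx, ddx.
   The values of x at negative times are irrelevant. *)
Definition halfline_C2 (x dx ddx : R -> 'M[R]_(H, k)) : Prop :=
  [/\ halfline_derivative x dx, halfline_derivative dx ddx &
      {within `[0, +oo[, continuous ddx}].

Definition avoids_singularities (N : nat) (c : 'I_N -> R -> 'rV[R]_k)
    (x : R -> 'M[R]_(H, k)) : Prop :=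
  forall t, 0 <= t ->
    (forall j i, row j (x t) != c i t) /\
    (forall l j, l != j -> row l (x t) != row j (x t)).

Definition satisfies_equation m (N : nat) (mt : 'I_N -> R)
    (c : 'I_N -> R -> 'rV[R]_k) (x ddx : R -> 'M[R]_(H, k)) : Prop :=
  forall t, 0 <= t -> forall j,
    m j *: row j (ddx t) =
    - (\sum_i (mt i * m j / enorm (row j (x t) - c i t) ^+ 3) *:
              (row j (x t) - c i t))
    - \sum_(l | l != j) (m l * m j / enorm (row j (x t) - row l (x t)) ^+ 3) *:
                        (row j (x t) - row l (x t)).

Definition parabolic_solution m (N : nat) (mt : 'I_N -> R)
    (c : 'I_N -> R -> 'rV[R]_k) (x : R -> 'M[R]_(H, k)) : Prop :=
  exists dx ddx : R -> 'M[R]_(H, k),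
    [/\ halfline_C2 x dx ddx, avoids_singularities c x,
        satisfies_equation m mt c x ddx,
        mnorm m (x t) @[t --> +oo] --> +oo &
        dx t @[t --> +oo] --> (0 : 'M[R]_(H, k))].

End Configurations.

Definition asymp_equiv {R : realType} (f g : R -> R) : Prop :=
  f t / g t @[t --> +oo] --> (1 : R).

(* Main.v *)
Require Import Defs.
From mathcomp Require Import all_boot all_order all_algebra.
From mathcomp Require Import all_classical all_reals all_analysis.
From mathcomp Require Import ring lra.
Set Implicit Arguments.
Unset Strict Implicit.
Unset Printing Implicit Defensive.
Import Order.TTheory GRing.Theory Num.Theory.
Import numFieldNormedType.Exports.
Local Open Scope classical_set_scope.
Local Open Scope ring_scope.

(** Write U0 = U(xi), lam = |x0| and G(y, b) for the acceleration field at the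
    configuration y when the centres are at the points b.  If all the centres
    were at the origin, lam ((t + t0) / t0)^(2/3) xi would be a parabolic solution
    for the t0 with 2 lam^3 = 9 U0 t0^2.  In the logarithmic time s given by
    (t + t0) / t0 = e^(3 s), put

      x(t) = lam e^(2 s) (xi + h(s)).

    Since G is homogeneous of degree -2, the equation of motion becomes

      h'' + h' = 2 (xi + h) + (2 / U0) G(xi + h, b(s)),

    where b(s) = c(t) / (lam e^(2 s)) decays exponentially and is small when lam
    is large.  The initial value h(0) = x0 / |x0| - xi is small when x0 lies in a
    thin cone, so the task is to solve this equation for every small h(0), with h
    tending to 0 at infinity.

    The linearization at h = 0, b = 0 is h'' + h' = (2 + (2 / U0) DG) h.  The
    operator on the right is self-adjoint, with the value 6 on xi and the value
    2 nu / U0 on a tangent eigenvector of the Hessian for the eigenvalue nu.  The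
    roots of a^2 + a = 2 nu / U0 are real and distinct, one on each side of -1/2,
    exactly when nu > - U0 / 8; this is where (BS) comes from.  In terms of w, with
    h = e^(- s / 2) w, the equation reads

      w'' = B w + remainder,   B = 9 / 4 + (2 / U0) DG >= delta > 0,

    and what is wanted is a bounded w with prescribed w(0).

    Such a w is a fixed point.  For large M, write the equation as
    w'' = M^2 w - F(s, w), so that F is M^2 - B up to the remainder.  By the maximum principle the solution operator of
    w'' = M^2 w - f, w(0) = 0, w bounded, has norm 1 / M^2 for the supremum of a
    Euclidean norm (lemmas [bounded_solution_mx] and [max_principle]); since B is
    self-adjoint, M^2 - B has norm at most M^2 - delta
    ([linearized_operator_contraction], where (BS) enters through the minimum of
    the quadratic form of DG on the tangent sphere, [minimal_tangent_eigenvector]).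
    The product of the two is less than 1, with room for the remainder, whose
    Lipschitz constant is small near xi because G is strictly differentiable
    there, uniformly in b ([force_strict]), and whose value at w = 0 is O(1 / lam)
    ([force_center_Lipschitz]).  Picard iteration concludes ([half_line_bvp],
    [logarithmic_time_solution]).

    As |h| = O(e^(- s / 2)), the configuration xi + h tends to xi, and every
    asymptotic assertion can be read off x = lam e^(2 s) (xi + h). *)

(** * Calculus of one variable *)

Section ScalarCalculus.
Context {R : realType}.
Implicit Types (f g F : R -> R) (a b s t K M : R).

Lemma is_derive_continuous f (l : R) s :
  is_derive s 1 f l -> {for s, continuous f}.
Proof. by move=> [df1 _]; exact/differentiable_continuous/derivable1_diffP. Qed.

Lemma ge0_derive_le f (df : R -> R) a b : a <= b ->
  (forall s, a <= s -> s <= b -> is_derive s 1 f (df s)) ->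
  (forall s, a <= s -> s <= b -> 0 <= df s) -> f a <= f b.
Proof.
move=> ab dfE df0.
have dfi s : s \in `]a, b[ -> is_derive s 1 f (df s).
  by rewrite in_itv /= => /andP[/ltW ? /ltW ?]; exact: dfE.
have cf : {within `[a, b], continuous f}.
  apply: continuous_in_subspaceT => s; rewrite inE /= in_itv /= => /andP[? ?].
  by apply: is_derive_continuous (dfE _ _ _).
have [s] := MVT_segment ab dfi cf.
rewrite in_itv /= => /andP[? ?] E; rewrite -subr_ge0 E.
by rewrite mulr_ge0 ?df0 ?subr_ge0.
Qed.

Lemma continuous_antiderivative f a : continuous f ->
  exists F, forall s, a < s -> is_derive s 1 F (f s).
Proof.
move=> cf; exists (fun x => (\int[lebesgue_measure]_(t in `[a, x]) f t)%R).
move=> s as_.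
have int : lebesgue_measure.-integrable `[a, s + 1] (EFin \o f).
  apply: continuous_compact_integrable; first exact: segment_compact.
  exact: continuous_subspaceT.
have [//||] := continuous_FTC1_closed _ int as_; first by rewrite ltrDl.
  exact: cf.
move=> d1 d2; apply: DeriveDef; first exact: d1.
by rewrite derive1E in d2; exact: d2.
Qed.

Lemma is_derive_addfun f g s df dg : is_derive s 1 f df -> is_derive s 1 g dg ->
  is_derive s 1 (fun t => f t + g t) (df + dg).
Proof. by move=> d1 d2; exact: is_deriveD. Qed.

Lemma is_derive_oppfun f s df : is_derive s 1 f df ->
  is_derive s 1 (fun t => - f t) (- df).
Proof. by move=> d1; exact: is_deriveN. Qed.

Lemma is_derive_mulfun f g s df dg : is_derive s 1 f df -> is_derive s 1 g dg ->
  is_derive s 1 (fun t => f t * g t) (df * g s + f s * dg).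
Proof.
move=> d1 d2; apply: is_derive_eq (is_deriveM d1 d2) _.
rewrite /GRing.scale /=; ring.
Qed.

Lemma is_derive_scalefun f s df c : is_derive s 1 f df ->
  is_derive s 1 (fun t => c * f t) (c * df).
Proof. by move=> d1; exact: (is_deriveZ c). Qed.

Lemma is_derive_expRM c s : is_derive s 1 (fun t => expR (c * t)) (c * expR (c * s)).
Proof.
have d1 : is_derive s 1 (fun t => c * t) (c * 1).
  by apply: is_derive_scalefun; exact: is_derive_id.
apply: is_derive_eq (is_derive1_comp (is_derive_expR _) d1) _.
by rewrite mulr1 mulrC.
Qed.

(** Because f(s) e^(- M s) is nondecreasing. *)
Lemma Gronwall_le f (df : R -> R) a b M : a <= b ->
  (forall s, a <= s -> s <= b -> is_derive s 1 f (df s)) ->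
  (forall s, a <= s -> s <= b -> M * f s <= df s) ->
  expR (M * (b - a)) * f a <= f b.
Proof.
move=> ab dfE dfM.
have H := @ge0_derive_le (fun s => expR (- M * s) * f s)
  (fun s => expR (- M * s) * (df s - M * f s)) a b ab.
have E : expR (M * b) = expR (M * (b - a)) * expR (M * a).
  by rewrite -expRD; congr expR; ring.
have : expR (- M * a) * f a <= expR (- M * b) * f b.
  apply: H => s sa sb.
    have d1 := dfE s sa sb; have d2 := is_derive_expRM (- M) s.
    apply: is_derive_eq (is_derive_mulfun d2 d1) _; ring.
  by rewrite mulr_ge0 ?expR_ge0 // subr_ge0 dfM.
rewrite -(ler_pM2l (expR_gt0 (M * b))) !mulrA [in leRHS]mulNr expRxMexpNx_1.
by rewrite mul1r E mulNr -(mulrA _ (expR (M * a))) expRxMexpNx_1 mulr1.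
Qed.

(** Factor the equation: with v = z' + M z - K / M, one has v' >= M v, so a
    positive value of v would force exponential growth; hence v <= 0, that is
    (z - K / M^2)' <= - M (z - K / M^2), and the sign at 0 propagates. *)
Lemma max_principle_le f (z z1 : R -> R) K C M : 0 < M ->
  (forall s, 0 <= s -> is_derive s 1 z (z1 s)) ->
  (forall s, 0 <= s -> is_derive s 1 z1 (M ^+ 2 * z s - f s)) ->
  (forall s, 0 <= s -> z s <= C) -> (forall s, 0 <= s -> z1 s <= C) ->
  (forall s, 0 <= s -> f s <= K) -> z 0 <= K / M ^+ 2 ->
  forall s, 0 <= s -> z s <= K / M ^+ 2.
Proof.
move=> M0 dz dz1 zC z1C fK z0.
pose v := fun s => z1 s + M * z s - K / M.
have M0' : M != 0 by rewrite gt_eqF.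
have vle0 s : 0 <= s -> v s <= 0.
  move=> s0; rewrite leNgt; apply/negP => vs.
  pose B := C + M * C - K / M.
  pose t := s + `|B| / (M * v s).
  have st : s <= t by rewrite lerDl divr_ge0 // mulr_ge0 // ltW.
  have vB : v t <= B.
    have t0 := le_trans s0 st.
    by rewrite /v /B lerB // lerD ?z1C // ler_pM2l // zC.
  have := @Gronwall_le v (fun s => M ^+ 2 * z s - f s + M * z1 s) s t M st.
  have dv : forall r, s <= r -> r <= t ->
      is_derive r 1 v (M ^+ 2 * z r - f r + M * z1 r).
    move=> r sr rt; have r0 := le_trans s0 sr.
    apply: is_derive_eq (is_derive_addfun (is_derive_addfun (dz1 _ r0)
      (is_derive_scalefun M (dz _ r0))) (is_derive_cst (- (K / M)) r 1)) _.
    by rewrite addr0.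
  move=> /(_ dv) H; have /H : forall r, s <= r -> r <= t ->
      M * v r <= M ^+ 2 * z r - f r + M * z1 r.
    move=> r sr rt; have := fK _ (le_trans s0 sr).
    suff -> : M * v r = M ^+ 2 * z r + M * z1 r - K by lra.
    by rewrite /v; field.
  apply/negP; rewrite -ltNge (le_lt_trans vB) //.
  apply: (@lt_le_trans _ _ ((1 + M * (t - s)) * v s)); last first.
    by rewrite ler_pM2r // expR_ge1Dx.
  have -> : (1 + M * (t - s)) * v s = v s + `|B|.
    by rewrite /t; field; rewrite M0' gt_eqF.
  by rewrite (le_lt_trans (ler_norm B)) // ltrDr.
move=> s s0.
have := @Gronwall_le (fun s => K / M ^+ 2 - z s) (fun s => - z1 s) 0 s (- M) s0.
have dK r : 0 <= r -> r <= s ->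
    is_derive r 1 (fun s => K / M ^+ 2 - z s) (- z1 r).
  move=> r0 _; apply: is_derive_eq (is_derive_addfun
    (is_derive_cst (K / M ^+ 2) r 1) (is_derive_oppfun (dz _ r0))) _.
  by rewrite add0r.
move=> /(_ dK) H; have /H {H} : forall r, 0 <= r -> r <= s ->
    - M * (K / M ^+ 2 - z r) <= - z1 r.
  move=> r r0 _; have := vle0 _ r0; rewrite /v.
  have -> : - M * (K / M ^+ 2 - z r) = M * z r - K / M by field.
  by move=> ?; lra.
move=> H; rewrite -subr_ge0 (le_trans _ H) // mulr_ge0 ?expR_ge0 // subr_ge0 //.
Qed.

(** Stands for the limit of two monotone families squeezing each other. *)
Lemma exists_separating (T : Type) (A : set T) (lo hi : T -> R) : A !=set0 ->
  (forall x y, A x -> A y -> lo x <= hi y) ->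
  exists l, forall x, A x -> lo x <= l /\ l <= hi x.
Proof.
move=> [r Ar] lohi; exists (sup (lo @` A)) => x Ax.
have ub y : A y -> ubound (lo @` A) (hi y) by move=> Ay _ [z Az <-]; exact: lohi.
split; first by apply: ub_le_sup; [exists (hi x); exact: ub|exists x].
by apply: ge_sup; [exists (lo r), r|exact: ub].
Qed.

End ScalarCalculus.

(** * Bounded solutions of a scalar linear equation on the half-line *)

Section ScalarBoundedSolution.
Context {R : realType}.
Implicit Types (f g F : R -> R) (a b s t K M : R).
(** With P' = e^(- M s) f and N' = e^(M s) f, the functions u = e^(M s) (p - P)
    and v = e^(- M s) (N + c) solve u' = M u - f and v' = f - M v, so that
    z = (u + v) / (2 M) is a solution.  The growing exponential leaves u bounded
    only when p is the limit of P at infinity, whereas c is free to adjust z(0). *)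
Lemma bounded_solution f K M z0 : 0 < M -> continuous f ->
  (forall s, `|f s| <= K) ->
  exists z z1 : R -> R, exists C, [/\ z 0 = z0,
    forall s, -1 < s -> is_derive s 1 z (z1 s),
    forall s, -1 < s -> is_derive s 1 z1 (M ^+ 2 * z s - f s) &
    forall s, 0 <= s -> `|z s| <= C /\ `|z1 s| <= C].
Proof.
move=> M0 cf fK.
have M0' : M != 0 by rewrite gt_eqF.
have cexp c : continuous (fun t : R => expR (c * t)).
  by move=> s; apply: is_derive_continuous (is_derive_expRM _ _).
have [P dP] : exists F, forall s, -1 < s -> is_derive s 1 F (expR (- M * s) * f s).
  by apply: continuous_antiderivative => s; apply: cvgM; [exact: cexp|exact: cf].
have [N dN] : exists F, forall s, -1 < s -> is_derive s 1 F (expR (M * s) * f s).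
  by apply: continuous_antiderivative => s; apply: cvgM; [exact: cexp|exact: cf].
have eI r : expR (M * r) * expR (- M * r) = 1 by rewrite mulNr expRxMexpNx_1.
have pm (s : R) : 0 <= s -> -1 < s by move=> ?; lra.
pose KM := K / M.
have KM0 : 0 <= KM by rewrite divr_ge0 ?(ltW M0) // (le_trans (normr_ge0 _) (fK 0)).
have dPe c s : 0 <= s ->
    is_derive s 1 (fun t => P t + c * KM * expR (- M * t)) (expR (- M * s) * (f s - c * K)).
  move=> /pm s0; apply: is_derive_eq (is_derive_addfun (dP _ s0)
    (is_derive_scalefun (c * KM) (is_derive_expRM (- M) s))) _.
  by rewrite /KM; field.
have dNe c s : 0 <= s ->
    is_derive s 1 (fun t => N t + c * KM * expR (M * t)) (expR (M * s) * (f s + c * K)).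
  move=> /pm s0; apply: is_derive_eq (is_derive_addfun (dN _ s0)
    (is_derive_scalefun (c * KM) (is_derive_expRM M s))) _.
  by rewrite /KM; field.
have fK1 s : f s - K <= 0 by rewrite subr_le0 (le_trans (ler_norm _)).
have fK2 s : 0 <= f s + K by have := fK s; rewrite ler_norml => /andP[? _]; lra.
(* P + (K / M) e^(- M s) decreases and P - (K / M) e^(- M s) increases, so that
   the limit p of P is within (K / M) e^(- M s) of P s. *)
have Phi s t : 0 <= s -> s <= t ->
    P t + KM * expR (- M * t) <= P s + KM * expR (- M * s).
  move=> s0 st; rewrite -lerN2 -subr_ge0.
  have /= := @ge0_derive_le R (fun t => - (P t + 1 * KM * expR (- M * t)))
    (fun s => - (expR (- M * s) * (f s - 1 * K))) s t st.
  rewrite !mul1r subr_ge0; apply.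
    move=> r sr _; have := is_derive_oppfun (dPe 1 r (le_trans s0 sr)).
    by rewrite !mul1r.
  by move=> r _ _; rewrite oppr_ge0 mulr_ge0_le0 ?expR_ge0.
have Plo s t : 0 <= s -> s <= t ->
    P s - KM * expR (- M * s) <= P t - KM * expR (- M * t).
  move=> s0 st.
  have /= := @ge0_derive_le R (fun t => P t + -1 * KM * expR (- M * t))
    (fun s => expR (- M * s) * (f s - -1 * K)) s t st.
  rewrite !mulN1r !mulNr !opprK; apply.
    move=> r sr _; have := dPe (-1) r (le_trans s0 sr).
    by rewrite !mulN1r opprK.
  by move=> r _ _; rewrite mulr_ge0 ?expR_ge0.
have sep s t : 0 <= s -> 0 <= t ->
    P s - KM * expR (- M * s) <= P t + KM * expR (- M * t).
  move=> s0 t0; have pos r : 0 <= KM * expR (- M * r) by rewrite mulr_ge0 ?expR_ge0.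
  have [st|/ltW ts] := leP s t.
    by have := Plo s t s0 st; have := pos t; lra.
  by have := Phi t s t0 ts; have := pos s; lra.
have [p pP0] := @exists_separating R R [set s | 0 <= s] _ _ (ex_intro _ 0 (lexx 0)) sep.
have pP s : 0 <= s -> `|p - P s| <= KM * expR (- M * s).
  by move=> /pP0[p1 p2]; rewrite ler_norml; apply/andP; split; lra.
have uB s : 0 <= s -> `|expR (M * s) * (p - P s)| <= KM.
  move=> s0; rewrite normrM ger0_norm ?expR_ge0 //.
  rewrite -[leRHS]mulr1 -(expRxMexpNx_1 (M * s)) mulrCA ler_pM2l ?expR_gt0 //.
  by rewrite -mulNr pP.
have NN s : 0 <= s -> `|N s - N 0| <= KM * expR (M * s).
  move=> s0.
  have H1 : N 0 + KM <= N s + KM * expR (M * s).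
    have /= := @ge0_derive_le R (fun t => N t + 1 * KM * expR (M * t))
      (fun s => expR (M * s) * (f s + 1 * K)) 0 s s0.
    rewrite !mul1r mulr0 expR0 mulr1; apply.
      by move=> r r0 _; have := dNe 1 r r0; rewrite !mul1r.
    by move=> r _ _; rewrite mulr_ge0 ?expR_ge0.
  have H2 : N s - KM * expR (M * s) <= N 0 - KM.
    have /= := @ge0_derive_le R (fun t => - (N t + -1 * KM * expR (M * t)))
      (fun s => - (expR (M * s) * (f s + -1 * K))) 0 s s0.
    rewrite !mulN1r !mulNr mulr0 expR0 mulr1 lerN2; apply.
      move=> r r0 _; have := is_derive_oppfun (dNe (-1) r r0).
      by rewrite !mulN1r.
    by move=> r _ _; rewrite oppr_ge0 mulr_ge0_le0 ?expR_ge0.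
  by rewrite ler_norml; apply/andP; split; lra.
pose c := 2 * M * z0 - (p - P 0) - N 0.
pose u s := expR (M * s) * (p - P s).
pose v s := expR (- M * s) * (N s + c).
have du s : -1 < s -> is_derive s 1 u (M * u s - f s).
  move=> s1; apply: is_derive_eq (is_derive_mulfun (is_derive_expRM M s)
    (is_derive_addfun (is_derive_cst p s 1) (is_derive_oppfun (dP _ s1)))) _.
  rewrite add0r /u -[f s in RHS]mul1r -(eI s) /=; ring.
have dv s : -1 < s -> is_derive s 1 v (f s - M * v s).
  move=> s1; apply: is_derive_eq (is_derive_mulfun (is_derive_expRM (- M) s)
    (is_derive_addfun (dN _ s1) (is_derive_cst c s 1))) _.
  rewrite addr0 /v -[f s in RHS]mul1r -(eI s) /=; ring.
have vB s : 0 <= s -> `|v s| <= `|N 0 + c| + KM.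
  move=> s0; rewrite normrM ger0_norm ?expR_ge0 //.
  have -> : N s + c = (N 0 + c) + (N s - N 0) by ring.
  have H : `|N 0 + c + (N s - N 0)| <= `|N 0 + c| + KM * expR (M * s).
    by rewrite (le_trans (ler_normD _ _)) // lerD2l NN.
  apply: (le_trans (ler_wpM2l (expR_ge0 _) H)).
  have -> : expR (- M * s) * (`|N 0 + c| + KM * expR (M * s)) =
      expR (- M * s) * `|N 0 + c| + KM.
    rewrite -[KM in RHS]mulr1 -(eI s); ring.
  rewrite lerD2r ler_piMl // expR_le1 mulNr oppr_le0 mulr_ge0 // ltW //.
pose C0 := `|N 0 + c| + KM + KM.
exists (fun s => (2 * M)^-1 * (u s + v s)), (fun s => 2^-1 * (u s - v s)).
exists ((2 * M)^-1 * C0 + 2^-1 * C0); split.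
- rewrite /u /v /c !mulr0 expR0; field.
  by rewrite M0'.
- move=> s s1; apply: is_derive_eq
    (is_derive_scalefun (2 * M)^-1 (is_derive_addfun (du s s1) (dv s s1))) _.
  by field.
- move=> s s1; apply: is_derive_eq (is_derive_scalefun 2^-1
    (is_derive_addfun (du s s1) (is_derive_oppfun (dv s s1)))) _.
  by field.
- move=> s s0; have C00 : 0 <= C0 by rewrite !addr_ge0.
  have uv : `|u s| + `|v s| <= C0.
    by rewrite addrC; exact: lerD (vB s s0) (uB s s0).
  have M2 : 0 <= (2 * M)^-1 by rewrite invr_ge0 mulr_ge0 // ltW.
  split.
    rewrite normrM ger0_norm // ler_wpDr ?mulr_ge0 ?invr_ge0 //.
    by rewrite ler_wpM2l // (le_trans (ler_normD _ _)).
  rewrite normrM (@ger0_norm _ 2^-1) ?invr_ge0 // ler_wpDl ?mulr_ge0 //.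
  by rewrite ler_wpM2l ?invr_ge0 // (le_trans (ler_normB _ _)).
Qed.

End ScalarBoundedSolution.

(** * The mass scalar product *)

(** For semi-definite forms, since it is also applied to the forms of
    self-adjoint operators that may have a kernel. *)
Lemma psd_Cauchy_Schwarz (R : realFieldType) (V : lmodType R) (a : V -> V -> R) :
  (forall c x y z, a (c *: x + y) z = c * a x z + a y z) ->
  (forall x y, a x y = a y x) -> (forall x, 0 <= a x x) ->
  forall x y, a x y ^+ 2 <= a x x * a y y.
Proof.
move=> al aC a0 x y.
have E t : 0 <= a x x + 2 * t * a x y + t ^+ 2 * a y y.
  have := a0 (t *: y + x); rewrite al (aC y) (aC x (t *: y + x)) !al (aC y x).
  by move=> h; apply: le_trans h _; rewrite le_eqVlt; apply/orP; left; apply/eqP; ring.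
(* If y is isotropic, the polynomial E is affine in t, hence constant. *)
have [y0|y0] := eqVneq (a y y) 0.
  have [->|xy] := eqVneq (a x y) 0; first by rewrite y0 expr0n mulr0.
  have := E (- (a x x + 1) / (2 * a x y)); rewrite y0 mulr0 addr0.
  have -> : a x x + 2 * (- (a x x + 1) / (2 * a x y)) * a x y = -1.
    by field.
  by rewrite lerNr oppr0 ler10.
have yp : 0 < a y y by rewrite lt_def y0 a0.
have := E (- a x y / a y y).
have -> : a x x + 2 * (- a x y / a y y) * a x y + (- a x y / a y y) ^+ 2 * a y y
  = (a x x * a y y - a x y ^+ 2) / a y y by field.
by rewrite pmulr_lge0 ?invr_gt0 // subr_ge0.
Qed.

Section MassProduct.
Context {R : realType} {H k : nat}.
Variables (m : 'I_H -> R).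
Hypothesis hm : forall j, 0 < m j.
Implicit Types (x y z : 'M[R]_(H, k)) (c : R).

Lemma mdotE x y : mdot m x y = \sum_j \sum_i m j * (x j i * y j i).
Proof.
apply: eq_bigr => j _; rewrite /dotv mulr_sumr.
by apply: eq_bigr => i _; rewrite !mxE.
Qed.

Lemma mdotC x y : mdot m x y = mdot m y x.
Proof. by rewrite !mdotE; do 2! apply: eq_bigr => ? _; rewrite [x _ _ * _]mulrC. Qed.

Lemma mdotPl c x y z : mdot m (c *: x + y) z = c * mdot m x z + mdot m y z.
Proof.
rewrite !mdotE mulr_sumr -big_split; apply: eq_bigr => j _.
rewrite mulr_sumr -big_split; apply: eq_bigr => i _.
rewrite !mxE /=; ring.
Qed.

Lemma mdotDl x y z : mdot m (x + y) z = mdot m x z + mdot m y z.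
Proof. by rewrite -[x]scale1r mdotPl scale1r mul1r. Qed.

Lemma mdot0l z : mdot m 0 z = 0.
Proof. by apply: (@addrI _ (mdot m 0 z)); rewrite -mdotDl !addr0. Qed.

Lemma mdotZl c x z : mdot m (c *: x) z = c * mdot m x z.
Proof. by rewrite -[_ *: _]addr0 mdotPl mdot0l addr0. Qed.

Lemma mdotNl x z : mdot m (- x) z = - mdot m x z.
Proof. by rewrite -scaleN1r mdotZl mulN1r. Qed.

Lemma mdotBl x y z : mdot m (x - y) z = mdot m x z - mdot m y z.
Proof. by rewrite mdotDl mdotNl. Qed.

Lemma mdotDr x y z : mdot m z (x + y) = mdot m z x + mdot m z y.
Proof. by rewrite mdotC mdotDl !(mdotC _ z). Qed.

Lemma mdotZr c x z : mdot m z (c *: x) = c * mdot m z x.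
Proof. by rewrite mdotC mdotZl (mdotC _ z). Qed.

Lemma mdotNr x z : mdot m z (- x) = - mdot m z x.
Proof. by rewrite mdotC mdotNl (mdotC _ z). Qed.

Lemma mdotBr x y z : mdot m z (x - y) = mdot m z x - mdot m z y.
Proof. by rewrite mdotDr mdotNr. Qed.

Lemma mdotxx_ge0 x : 0 <= mdot m x x.
Proof.
rewrite mdotE; do 2! apply: sumr_ge0 => ? _.
by rewrite mulr_ge0 ?(ltW (hm _)) // -expr2 sqr_ge0.
Qed.

Lemma mnorm_ge0 x : 0 <= mnorm m x. Proof. exact: sqrtr_ge0. Qed.

Lemma sqr_mnorm x : mnorm m x ^+ 2 = mdot m x x.
Proof. by rewrite sqr_sqrtr // mdotxx_ge0. Qed.

Lemma mdot_le x y : mdot m x y <= mnorm m x * mnorm m y.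
Proof.
apply: le_trans (ler_norm _) _.
rewrite -(@ler_pXn2r _ 2) ?nnegrE ?mulr_ge0 ?mnorm_ge0 //.
rewrite real_normK ?num_real // exprMn !sqr_mnorm.
exact: psd_Cauchy_Schwarz mdotPl mdotC mdotxx_ge0 _ _.
Qed.

Lemma mnormZ c x : mnorm m (c *: x) = `|c| * mnorm m x.
Proof. by rewrite /mnorm mdotZl mdotZr mulrA -expr2 sqrtrM ?sqr_ge0 // sqrtr_sqr. Qed.

Lemma mnormN x : mnorm m (- x) = mnorm m x.
Proof. by rewrite -scaleN1r mnormZ normrN1 mul1r. Qed.

Lemma mnorm0 : mnorm m (0 : 'M[R]_(H, k)) = 0.
Proof. by rewrite /mnorm mdot0l sqrtr0. Qed.

Lemma mnormD x y : mnorm m (x + y) <= mnorm m x + mnorm m y.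
Proof.
rewrite -(@ler_pXn2r _ 2) ?nnegrE ?addr_ge0 ?mnorm_ge0 //.
rewrite sqrrD !sqr_mnorm mdotDl !mdotDr (mdotC y x).
have := mdot_le x y; lra.
Qed.

Lemma mnorm_le (C : R) x : 0 <= C -> mdot m x x <= C ^+ 2 -> mnorm m x <= C.
Proof.
by move=> C0; rewrite -sqr_mnorm ler_pXn2r ?nnegrE ?mnorm_ge0.
Qed.

Lemma coord_le_norm x j i : `|x j i| <= `|x|.
Proof.
rewrite [leRHS]/Num.Def.normr /= mx_normrE.
exact: (le_bigmax _ (fun p : 'I_H * 'I_k => `|x p.1 p.2|) (j, i)).
Qed.

Lemma norm_le_coord x (C : R) : 0 <= C -> (forall j i, `|x j i| <= C) -> `|x| <= C.
Proof.
move=> C0 xC; rewrite [leLHS]/Num.Def.normr /= mx_normrE.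
by apply: bigmax_le => // -[j i] _; exact: xC.
Qed.

Lemma mnorm_le_norm : exists2 C, 0 < C & forall x, mnorm m x <= C * `|x|.
Proof.
pose A := \sum_j \sum_(i < k) m j.
have A0 : 0 <= A by do 2! apply: sumr_ge0 => ? _; exact: ltW.
exists (1 + A) => [|x]; first by rewrite ltr_pwDl.
apply: mnorm_le; first by rewrite mulr_ge0 // ltW // ltr_pwDl.
rewrite exprMn; apply: (@le_trans _ _ (A * `|x| ^+ 2)); last first.
  rewrite ler_wpM2r ?sqr_ge0 //; nra.
rewrite mdotE mulr_suml; apply: ler_sum => j _.
rewrite mulr_suml; apply: ler_sum => i _.
rewrite ler_wpM2l ?(ltW (hm _)) // -expr2 -real_normK ?num_real //.
by rewrite ler_pXn2r ?nnegrE // coord_le_norm.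
Qed.

Lemma norm_le_mnorm : exists2 C, 0 < C & forall x, `|x| <= C * mnorm m x.
Proof.
pose A := \sum_j (Num.sqrt (m j))^-1.
have B0 j : 0 < (Num.sqrt (m j))^-1 by rewrite invr_gt0 sqrtr_gt0.
have A0 : 0 <= A by apply: sumr_ge0 => ? _; exact: ltW.
exists (1 + A) => [|x]; first by rewrite ltr_pwDl.
apply: norm_le_coord => [|j i].
  by rewrite mulr_ge0 ?mnorm_ge0 // addr_ge0.
have : Num.sqrt (m j) * `|x j i| <= mnorm m x.
  rewrite -sqrtr_sqr -sqrtrM ?(ltW (hm _)) // ler_wsqrtr // mdotE.
  rewrite (bigD1 j) //= (bigD1 i) //= -expr2 -addrA lerDl addr_ge0 //.
    by apply: sumr_ge0 => l _; rewrite -expr2 mulr_ge0 ?sqr_ge0 // ltW.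
  by do 2! apply: sumr_ge0 => ? _; rewrite -expr2 mulr_ge0 ?sqr_ge0 // ltW.
rewrite mulrC -ler_pdivlMr ?sqrtr_gt0 // => /le_trans; apply.
rewrite mulrC ler_wpM2r ?mnorm_ge0 //.
rewrite ler_wpDl // /A (bigD1 j) //= lerDl.
by apply: sumr_ge0 => ? _; exact: ltW.
Qed.

Lemma mnorm_eq0 x : mnorm m x = 0 -> x = 0.
Proof.
have [C C0 xC] := norm_le_mnorm => x0.
by apply/eqP; rewrite -normr_le0 (le_trans (xC _)) // x0 mulr0.
Qed.

End MassProduct.

(** * A boundary value problem at infinity *)

Section Geometric.
Context {R : realType}.

Lemma geometric_le0 (x A q : R) : 0 <= q -> q < 1 ->
  (forall n : nat, x <= A * q ^+ n) -> x <= 0.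
Proof.
move=> q0 q1 xA; have := @cvg_geometric R A q.
rewrite ger0_norm // => /(_ q1) h.
by apply: cvgr_to_ge h _; apply: nearW => n; exact: xA.
Qed.

(** The intervals of centre u_n and half-length A q^n / (1 - q) are nested. *)
Lemma geometric_limit (u : nat -> R) (A q : R) : 0 <= q -> q < 1 ->
  (forall n, `|u n.+1 - u n| <= A * q ^+ n) ->
  exists l, forall n, `|l - u n| <= A / (1 - q) * q ^+ n.
Proof.
move=> q0 q1 du; have q1' : 0 < 1 - q by rewrite subr_gt0.
have q1'' : 1 - q != 0 by rewrite gt_eqF.
pose B := A / (1 - q).
have A0 : 0 <= A by have := du 0%N; rewrite expr0 mulr1; exact: le_trans.
have B0 : 0 <= B by rewrite divr_ge0 // ltW.
have BE n : A * q ^+ n = B * q ^+ n - B * q ^+ n.+1.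
  by rewrite exprS /B; field.
have mono n p : `|u (n + p)%N - u n| <= B * q ^+ n - B * q ^+ (n + p).
  elim: p => [|p IH]; first by rewrite addn0 !subrr normr0.
  have := du (n + p)%N; rewrite addnS BE !ler_norml => /andP[h1 h2].
  by move: IH; rewrite ler_norml => /andP[h3 h4]; apply/andP; split; lra.
have sep s t : True -> True -> u s - B * q ^+ s <= u t + B * q ^+ t.
  move=> _ _; have pos r : 0 <= B * q ^+ r by rewrite mulr_ge0 ?exprn_ge0.
  have [st|/ltnW ts] := leqP s t.
    have := mono s (t - s)%N; rewrite subnKC // ler_norml => /andP[h1 h2].
    by have := pos t; lra.
  have := mono t (s - t)%N; rewrite subnKC // ler_norml => /andP[h1 h2].
  by have := pos s; lra.
have [l lP] := @exists_separating R nat setT _ _ (ex_intro _ 0%N I) sep.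
exists l => n; have [h1 h2] := lP n I.
by rewrite ler_norml; apply/andP; split; rewrite -/B; lra.
Qed.

Lemma uniform_limit_cts (w : R -> R) (v : nat -> R -> R) (A q : R) :
  0 <= q -> q < 1 -> (forall n, continuous (v n)) ->
  (forall n s, `|w s - v n s| <= A * q ^+ n) -> continuous w.
Proof.
move=> q0 q1 cv wv s; apply/cvgrPdist_le => e e0.
have [n nP] : exists n, A * q ^+ n <= e / 3.
  apply: contrapT => /forallNP h.
  have : e / 3 <= 0 by apply: (@geometric_le0 _ A q) => // n; apply/ltW; rewrite ltNge; apply/negP/h.
  by rewrite leNgt divr_gt0.
have /cvgrPdist_le /(_ (e / 3)) := cv n s.
rewrite divr_gt0 // => /(_ isT); apply: filterS => t vt.
have -> : w s - w t = (w s - v n s) + (v n s - v n t) - (w t - v n t) by ring.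
apply: (le_trans (ler_normB _ _)); rewrite (splitr e).
have := ler_normD (w s - v n s) (v n s - v n t).
have := wv n s; have := wv n t; lra.
Qed.

End Geometric.

Section HalfLine.
Context {R : realType} {H k : nat}.
Variables (m : 'I_H -> R).
Hypothesis hm : forall j, 0 < m j.
Local Notation V := 'M[R]_(H, k).
Implicit Types (w f : R -> V) (e : V) (s M K C : R).

Definition continuous_coord w := forall j i, continuous (fun s => w s j i).

Definition derive_coord w (w1 : R -> V) s :=
  forall j i, is_derive s 1 (fun t => w t j i) (w1 s j i).

Lemma is_derive_sumfun (n : nat) (f : 'I_n -> R -> R) (df : 'I_n -> R) s :
  (forall i, is_derive s 1 (f i) (df i)) ->
  is_derive s 1 (fun t => \sum_i f i t) (\sum_i df i).
Proof.
move=> fi; have := @is_derive_sum R R R n f s 1 df fi.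
by congr is_derive; apply/funext => t; rewrite fct_sumE.
Qed.

Lemma is_derive_mdot e w w1 s : derive_coord w w1 s ->
  is_derive s 1 (fun t => mdot m e (w t)) (mdot m e (w1 s)).
Proof.
move=> dw; rewrite [mdot m e (w1 s)]mdotE.
have -> : (fun t => mdot m e (w t)) =
    (fun t => \sum_j \sum_i m j * (e j i * w t j i)).
  by apply/funext => t; rewrite mdotE.
do 2! (apply: is_derive_sumfun => ?).
by do 2! apply: is_derive_scalefun.
Qed.

Lemma mdot_bounded e w C : (forall s, 0 <= s -> forall j i, `|w s j i| <= C) ->
  exists C', forall s, 0 <= s -> mdot m e (w s) <= C'.
Proof.
move=> wC; exists (\sum_j \sum_i m j * (`|e j i| * C)) => s s0.
rewrite mdotE; apply: ler_sum => j _; apply: ler_sum => i _.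
rewrite ler_wpM2l ?(ltW (hm _)) // (le_trans (ler_norm _)) // normrM.
by rewrite ler_wpM2l // wC.
Qed.

(** Testing the equation against the fixed vector e = w(s) reduces it to the
    scalar case without losing a constant, whereas bounding the entries one by
    one would; a constant above 1 / M^2 would ruin the contraction. *)
Lemma max_principle (w w1 f : R -> V) K C M : 0 < M ->
  (forall s, 0 <= s -> derive_coord w w1 s) ->
  (forall s, 0 <= s -> derive_coord w1 (fun s => M ^+ 2 *: w s - f s) s) ->
  (forall s, 0 <= s -> forall j i, `|w s j i| <= C /\ `|w1 s j i| <= C) ->
  (forall s, 0 <= s -> mnorm m (f s) <= K) -> mnorm m (w 0) <= K / M ^+ 2 ->
  forall s, 0 <= s -> mnorm m (w s) <= K / M ^+ 2.
Proof.
move=> M0 dw dw1 wC fK w0 s s0.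
pose e := w s.
have [C1 hC1] := @mdot_bounded e w C (fun s hs j i => (wC s hs j i).1).
have [C2 hC2] := @mdot_bounded e w1 C (fun s hs j i => (wC s hs j i).2).
have [->|e0] := eqVneq (mnorm m e) 0.
  rewrite divr_ge0 ?sqr_ge0 //.
  by apply: le_trans (fK 0 (lexx 0)); exact: mnorm_ge0.
have ep : 0 < mnorm m e by rewrite lt_def e0 mnorm_ge0.
have : mdot m e (w s) <= mnorm m e * K / M ^+ 2.
  apply: (@max_principle_le _ (fun t => mdot m e (f t)) (fun t => mdot m e (w t))
    (fun t => mdot m e (w1 t)) _ (Num.max C1 C2)) => //.
  - by move=> t /dw; exact: is_derive_mdot.
  - move=> t /dw1 /(is_derive_mdot e) d1; apply: is_derive_eq d1 _.
    by rewrite mdotBr mdotZr.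
  - by move=> t /hC1; rewrite le_max => ->.
  - by move=> t /hC2; rewrite le_max => ->; rewrite orbT.
  - by move=> t /fK h; rewrite (le_trans (mdot_le hm _ _)) // ler_wpM2l ?mnorm_ge0.
  - by rewrite (le_trans (mdot_le hm _ _)) // -mulrA ler_wpM2l ?mnorm_ge0.
by rewrite -/e -sqr_mnorm // expr2 -mulrA ler_pM2l.
Qed.

Lemma bounded_solution_mx f K M (w0 : V) : 0 < M -> continuous_coord f ->
  (forall s, mnorm m (f s) <= K) ->
  exists w w1 : R -> V, exists C, [/\ w 0 = w0,
    forall s, -1 < s -> derive_coord w w1 s,
    forall s, -1 < s -> derive_coord w1 (fun s => M ^+ 2 *: w s - f s) s &
    forall s, 0 <= s -> forall j i, `|w s j i| <= C /\ `|w1 s j i| <= C].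
Proof.
move=> M0 cf fK.
have [D D0 hD] := norm_le_mnorm (k := k) hm.
have /choice[z hz] : forall p : 'I_H * 'I_k, exists z : (R -> R) * (R -> R) * R,
   [/\ z.1.1 0 = w0 p.1 p.2,
    forall s, -1 < s -> is_derive s 1 z.1.1 (z.1.2 s),
    forall s, -1 < s -> is_derive s 1 z.1.2 (M ^+ 2 * z.1.1 s - f s p.1 p.2) &
    forall s, 0 <= s -> `|z.1.1 s| <= z.2 /\ `|z.1.2 s| <= z.2].
  move=> [j i]; have fB s : `|f s j i| <= D * K.
    rewrite (le_trans (coord_le_norm _ _ _)) // (le_trans (hD _)) //.
    by rewrite ler_pM2l.
  have [z [z1 [C [h1 h2 h3 h4]]]] := bounded_solution (w0 j i) M0 (cf j i) fB.
  by exists (z, z1, C).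
exists (fun s => \matrix_(j, i) (z (j, i)).1.1 s).
exists (fun s => \matrix_(j, i) (z (j, i)).1.2 s).
exists (\sum_p (z p).2).
have zle p : (z p).2 <= \sum_p (z p).2.
  rewrite (bigD1 p) //= lerDl; apply: sumr_ge0 => q _.
  by have [_ _ _ /(_ 0 (lexx 0))[+ _]] := hz q; exact: le_trans.
split.
- by apply/matrixP => j i; rewrite mxE; have [] := hz (j, i).
- move=> s s1 j i; have [_ /(_ s s1) h _ _] := hz (j, i).
  by rewrite mxE (_ : (fun t => _) = (z (j, i)).1.1) //; apply/funext => t; rewrite mxE.
- move=> s s1 j i; have [_ _ /(_ s s1) h _] := hz (j, i).
  rewrite !mxE (_ : (fun t => _) = (z (j, i)).1.2) //.
  by apply/funext => t; rewrite mxE.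
- move=> s s0 j i; have [_ _ _ /(_ s s0)[h1 h2]] := hz (j, i).
  by rewrite !mxE !(le_trans _ (zle (j, i))).
Qed.

(** Picard iteration for the solution operator of w'' = M^2 w - f, whose norm
    1 / M^2 meets the Lipschitz constant kap < M^2 of F.  The assumptions on F
    concern nonnegative times; therefore each iterate is frozen at its value at 0
    on the negative half-line, which keeps it continuous and in the eps-ball
    at all times. *)
Lemma half_line_bvp (F : R -> V -> V) (eps kap M : R) (w0 : V) :
  0 < M -> 0 < eps -> 0 <= kap -> kap < M ^+ 2 ->
  (forall w, continuous_coord w -> (forall s, mnorm m (w s) <= eps) ->
    continuous_coord (fun s => F (Num.max 0 s) (w s))) ->
  (forall s, 0 <= s -> forall x y, mnorm m x <= eps -> mnorm m y <= eps ->
    mnorm m (F s x - F s y) <= kap * mnorm m (x - y)) ->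
  (forall s, 0 <= s -> mnorm m (F s 0) <= (M ^+ 2 - kap) * eps) ->
  mnorm m w0 <= eps ->
  exists w w1 : R -> V, exists C, [/\ w 0 = w0,
    forall s, 0 <= s -> derive_coord w w1 s,
    forall s, 0 <= s -> derive_coord w1 (fun s => M ^+ 2 *: w s - F s (w s)) s &
    forall s, 0 <= s -> mnorm m (w s) <= eps /\ forall j i, `|w1 s j i| <= C].
Proof.
move=> M0 eps0 kap0 kapM cF lF F0 w0eps.
have M2 : 0 < M ^+ 2 by rewrite exprn_gt0.
have M2' : M ^+ 2 != 0 by rewrite gt_eqF.
pose fz (w : R -> V) := fun s => w (Num.max 0 s).
have fzE w s : 0 <= s -> fz w s = w s by move=> s0; rewrite /fz max_r.
pose E w := continuous_coord w /\ forall s, mnorm m (w s) <= eps.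
pose G w := fun s => F (Num.max 0 s) (w s).
have GB w s : E w -> mnorm m (G w s) <= M ^+ 2 * eps.
  move=> [_ wB]; have s0 : 0 <= Num.max 0 s by rewrite le_max lexx.
  rewrite -[G w s](subrK (F (Num.max 0 s) 0)) (le_trans (mnormD hm _ _)) //.
  have := lF _ s0 (w s) 0 (wB s); rewrite mnorm0 subr0 => /(_ (ltW eps0)) h.
  have := ler_wpM2l kap0 (wB s); have := F0 _ s0; rewrite /G; lra.
pose sol w (v : (R -> V) * (R -> V)) := exists C, [/\ v.1 0 = w0,
    forall s, 0 <= s -> derive_coord v.1 v.2 s,
    forall s, 0 <= s -> derive_coord v.2 (fun s => M ^+ 2 *: v.1 s - G w s) s,
    forall s, 0 <= s -> forall j i, `|v.1 s j i| <= C /\ `|v.2 s j i| <= C &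
    continuous_coord (fz v.1)].
have /choice[T hT] : forall w, exists v, E w -> sol w v.
  move=> w; have [Ew|nE] := pselect (E w); last by exists (w, w).
  have [v [v1 [C [h1 h2 h3 h4]]]] := bounded_solution_mx w0 M0 (cF w Ew.1 Ew.2)
    (fun s => GB w s Ew).
  exists (v, v1) => _; exists C; split => //.
  - by move=> s s0; apply: h2; lra.
  - by move=> s s0; apply: h3; lra.
  move=> j i s.
  suff h : {for s, continuous ((fun s => v s j i) \o Num.max 0)} by exact: h.
  apply: continuous_comp.
    by apply: continuous_max; [exact: cst_continuous|exact: id].
  apply: is_derive_continuous (h2 _ _ j i).
  have : 0 <= Num.max 0 s by rewrite le_max lexx.
  by move=> ?; lra.
have compare w v a b K : E w -> E v -> sol w a -> sol v b ->
    (forall s, mnorm m (w s - v s) <= K) ->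
    forall s, 0 <= s -> mnorm m (a.1 s - b.1 s) <= kap * K / M ^+ 2.
  move=> [_ wB] [_ vB] [Ca [a0 da da1 aC _]] [Cb [b0 db db1 bC _]] wv.
  apply: (@max_principle (fun s => a.1 s - b.1 s) (fun s => a.2 s - b.2 s)
     (fun s => G w s - G v s) _ (Ca + Cb)) => //.
  - move=> s s0 j i; rewrite !mxE (_ : (fun t => _) = (fun t => a.1 t j i - b.1 t j i)).
      exact: is_derive_addfun (da _ s0 j i) (is_derive_oppfun (db _ s0 j i)).
    by apply/funext => t; rewrite !mxE.
  - move=> s s0 j i; rewrite (_ : (fun t => _) = (fun t => a.2 t j i - b.2 t j i)).
      apply: is_derive_eq (is_derive_addfun (da1 _ s0 j i)
        (is_derive_oppfun (db1 _ s0 j i))) _.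
      by rewrite !mxE; ring.
    by apply/funext => t; rewrite !mxE.
  - move=> s s0 j i; rewrite !mxE; have [h1 h2] := aC _ s0 j i.
    have [h3 h4] := bC _ s0 j i.
    by split; rewrite (le_trans (ler_normB _ _)) // lerD.
  - move=> s s0; rewrite (le_trans (lF _ _ _ _ (wB s) (vB s))) ?le_max ?lexx //.
    by rewrite ler_wpM2l.
  - rewrite a0 b0 subrr mnorm0 divr_ge0 ?(ltW M2) // mulr_ge0 //.
    by apply: le_trans (wv 0); exact: mnorm_ge0.
have ET w : E w -> E (fz (T w).1).
  move=> Ew; have [C [v0 dv dv1 vC cv]] := hT _ Ew; split => // s.
  have : mnorm m (fz (T w).1 s) <= M ^+ 2 * eps / M ^+ 2.
    apply: (max_principle M0 dv dv1 vC) => [t _||]; [exact: GB| |].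
      by rewrite v0 mulrAC mulfV // mul1r.
    by rewrite le_max lexx.
  by rewrite mulrAC mulfV // mul1r.
pose ws := fix ws n : R -> V := if n is n'.+1 then fz (T (ws n')).1 else fun=> 0.
have Ews n : E (ws n).
  elim: n => [|n IH]; last exact: ET.
  by split=> [j i s|s]; [exact: cst_continuous|rewrite mnorm0 ltW].
pose q := kap / M ^+ 2.
have q0 : 0 <= q by rewrite divr_ge0 // ltW.
have q1 : q < 1 by rewrite ltr_pdivrMr // mul1r.
have dws n : forall s, mnorm m (ws n.+1 s - ws n s) <= eps * q ^+ n.
  elim: n => [|n IH] s.
    by rewrite expr0 mulr1 subr0; have [_] := Ews 1%N.
  have := compare _ _ _ _ _ (Ews n.+1) (Ews n) (hT _ (Ews n.+1)) (hT _ (Ews n)) IH.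
  have s0 : 0 <= Num.max 0 s by rewrite le_max lexx.
  move=> /(_ _ s0); rewrite /= /fz => /le_trans; apply.
  rewrite (exprS q n); move: (q ^+ n) => y; rewrite le_eqVlt /q; apply/orP; left.
  by apply/eqP; field; rewrite gt_eqF.
have [D D0 hD] := norm_le_mnorm (k := k) hm.
have [B B0 hB] := mnorm_le_norm (k := k) hm.
have /choice[wl hwl] : forall p : R * ('I_H * 'I_k), exists l, forall n,
    `|l - ws n p.1 p.2.1 p.2.2| <= D * eps / (1 - q) * q ^+ n.
  move=> [s [j i]]; apply: geometric_limit => // n /=.
  have := coord_le_norm (ws n.+1 s - ws n s) j i; rewrite !mxE => /le_trans; apply.
  by rewrite (le_trans (hD _)) // -mulrA ler_pM2l //; exact: dws.
pose w s := \matrix_(j, i) wl (s, (j, i)).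
pose A := D * eps / (1 - q).
have A0 : 0 <= A by rewrite divr_ge0 ?subr_ge0 ?(ltW q1) // mulr_ge0 ?ltW.
have wws n s : mnorm m (w s - ws n s) <= B * A * q ^+ n.
  rewrite (le_trans (hB _)) // -mulrA ler_pM2l //; apply: norm_le_coord.
    by rewrite mulr_ge0 ?exprn_ge0.
  by move=> j i; rewrite !mxE; exact: (hwl (s, (j, i))).
have Ew : E w.
  split=> [j i|s].
    apply: (@uniform_limit_cts _ _ (fun n s => ws n s j i) A q) => // [n|n s].
      exact: (Ews n).1.
    by rewrite mxE; exact: (hwl (s, (j, i))).
  rewrite -subr_le0; apply: (@geometric_le0 _ _ (B * A) q) => // n.
  rewrite lerBlDr -[w s](subrK (ws n s)) (le_trans (mnormD hm _ _)) //.
  by rewrite lerD //; exact: (Ews n).2.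
have [C [v0 dv dv1 vC cv]] := hT _ Ew.
have vw s : 0 <= s -> (T w).1 s = w s.
  move=> s0; apply/eqP; rewrite -subr_eq0; apply/eqP/(mnorm_eq0 hm)/eqP.
  rewrite eq_le mnorm_ge0 andbT.
  apply: (@geometric_le0 _ _ (2 * (B * A)) q) => // n.
  have h1 := compare _ _ _ _ _ Ew (Ews n) (hT _ Ew) (hT _ (Ews n)) (wws n) _ s0.
  have h2 := wws n.+1 s; rewrite /= fzE // in h2.
  have -> : (T w).1 s - w s = ((T w).1 s - (T (ws n)).1 s) - (w s - (T (ws n)).1 s).
    by rewrite opprB addrA subrK.
  rewrite (le_trans (mnormD hm _ _)) // mnormN.
  have BAq : 0 <= B * A * q ^+ n by rewrite mulr_ge0 ?exprn_ge0 // mulr_ge0 // ltW.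
  have h3 : kap * (B * A * q ^+ n) / M ^+ 2 <= B * A * q ^+ n.
    have -> : kap * (B * A * q ^+ n) / M ^+ 2 = q * (B * A * q ^+ n).
      by move: (q ^+ n) => y; rewrite /q; field; rewrite gt_eqF.
    by rewrite ler_piMl // ltW.
  have h4 : B * A * q ^+ n.+1 <= B * A * q ^+ n.
    by rewrite exprS mulrCA ler_piMl // ltW.
  lra.
exists (T w).1, (T w).2, C; split => // s s0.
  by move: (dv1 s s0); rewrite /derive_coord /G max_r // vw.
rewrite vw //; split; first exact: Ew.2.
by move=> j i; have [] := vC s s0 j i.
Qed.

End HalfLine.

(** * Strict differentiability *)

Section StrictDiff.
Context {R : realType}.

(** Compared with differentiability at x, the two moving points y and z give a
    small Lipschitz constant for f - L near x, which is what the contraction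
    requires; and the notion is stable under sums, products and composition
    without any reference to derivatives at other points. *)
Definition strict_diff (V W : normedModType R) (f : V -> W) (x : V) (L : V -> W) :=
  (exists C, forall v, `|L v| <= C * `|v|) /\
  forall e, 0 < e -> exists2 r, 0 < r & forall y z,
    `|y - x| < r -> `|z - x| < r -> `|f y - f z - L (y - z)| <= e * `|y - z|.

Lemma common_radius (I : finType) (r : I -> R) : (forall i, 0 < r i) ->
  exists2 r0, 0 < r0 & forall i, r0 <= r i.
Proof.
move=> rp; have [r0 h1 h2] : exists2 r0 : R, 0 < r0 & forall i, r0 < r i.
  have h : \forall r0 \near 0^'+, forall i, r0 < r i.
    by apply: filter_forall => i; exact: nbhs_right_lt.
  by have [r0 [? ?]] := filter_ex (filterI (nbhs_right_gt 0) h); exists r0.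
by exists r0 => // i; exact: ltW.
Qed.

Section Generic.
Context {V W : normedModType R}.
Implicit Types (f g : V -> W) (L : V -> W) (x y z v : V).

Lemma strict_diff_Lipschitz f x L : strict_diff f x L ->
  exists2 C, 0 < C & exists2 r, 0 < r & forall y z,
    `|y - x| < r -> `|z - x| < r -> `|f y - f z| <= C * `|y - z|.
Proof.
move=> [[C LC] /(_ 1 ltr01)[r r0 fr]]; exists (`|C| + 1); first by rewrite ltr_wpDl.
exists r => // y z yr zr; rewrite -[f y - f z](subrK (L (y - z))).
rewrite (le_trans (ler_normD _ _)) // addrC mulrDl lerD ?fr //.
by rewrite (le_trans (LC _)) // ler_wpM2r // ler_norm.
Qed.

Lemma strict_diff_continuous f x L : strict_diff f x L -> {for x, continuous f}.
Proof.
move=> /strict_diff_Lipschitz[C C0 [r r0 fr]]; apply/cvgrPdist_le => e e0.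
have h : 0 < Num.min r (e / C) by rewrite lt_min r0 divr_gt0.
near=> y; have yx : `|x - y| < Num.min r (e / C).
  by near: y; apply: (@cvgr_dist_lt _ _ _ _ _ id x) => //; exact: cvg_id.
move: yx; rewrite lt_min => /andP[h1 h2].
rewrite (le_trans (fr _ _ _ _)) ?subrr ?normr0 // 1?distrC //.
by rewrite mulrC -ler_pdivlMr // ltW // distrC.
Unshelve. all: by end_near. Qed.

Lemma strict_diff_is_derive f x L v :
  (forall c u, L (c *: u) = c *: L u) -> strict_diff f x L -> is_derive x v f (L v).
Proof.
move=> Lh [_ fL].
have : h^-1 *: (f (h *: v + x) - f x) @[h --> 0^'] --> L v.
  apply/cvgrPdist_le => e e0.
  have v1 : 0 < 1 + `|v| by rewrite ltr_pwDl.
  have [r r0 fr] := fL _ (divr_gt0 e0 v1).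
  near=> h; have h0 : h != 0 by near: h; exact: nbhs_dnbhs_neq.
  have hr : `|h| < r / (1 + `|v|) by near: h; apply: dnbhs0_lt; rewrite divr_gt0.
  have := fr (h *: v + x) x; rewrite subrr normr0 addrK normrZ => H.
  have {}H : `|f (h *: v + x) - f x - L (h *: v)| <= e / (1 + `|v|) * (`|h| * `|v|).
    apply: H => //; rewrite ltr_pdivlMr // in hr.
    by rewrite (le_lt_trans _ hr) // ler_wpM2l // lerDr.
  have -> : L v - h^-1 *: (f (h *: v + x) - f x) =
      - (h^-1 *: (f (h *: v + x) - f x - L (h *: v))).
    by rewrite Lh [in RHS]scalerBr scalerA mulVf // scale1r opprB.
  rewrite normrN normrZ normfV ler_pdivrMl ?normr_gt0 // (le_trans H) //.
  rewrite (_ : e / _ * _ = `|h| * e * (`|v| / (1 + `|v|))); last by field; rewrite gt_eqF.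
  by rewrite ler_piMr ?mulr_ge0 ?(ltW e0) // ler_pdivrMr // mul1r lerDr.
move=> h; apply: DeriveDef; first by apply/cvg_ex; exists (L v).
exact/cvg_lim.
Unshelve. all: by end_near. Qed.

End Generic.

Section RealValued.
Context {V : normedModType R}.
Implicit Types (f g L : V -> R) (x y z v : V).

Lemma strict_diff_linear L x : (forall y z, L (y - z) = L y - L z) ->
  (exists C, forall v, `|L v| <= C * `|v|) -> strict_diff L x L.
Proof.
move=> LB LC; split=> // e e0; exists 1 => // y z _ _.
by rewrite LB subrr normr0 mulr_ge0 // ltW.
Qed.

Lemma strict_diff_cst (c : R) x : strict_diff (fun=> c : R) x (fun=> 0 : R).
Proof.
split=> [|e e0]; first by exists 0 => v; rewrite normr0 mul0r.
by exists 1 => // y z _ _; rewrite !subrr normr0 mulr_ge0 // ltW.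
Qed.

Lemma strict_diffD f g x L L' : strict_diff f x L -> strict_diff g x L' ->
  strict_diff (fun y => f y + g y : R) x (fun v => L v + L' v : R).
Proof.
move=> [[C LC] fL] [[C' LC'] gL]; split=> [|e e0].
  by exists (C + C') => v; rewrite (le_trans (ler_normD _ _)) // mulrDl lerD.
have e2 : 0 < e / 2 by rewrite divr_gt0.
have [r r0 fr] := fL _ e2; have [r' r0' gr] := gL _ e2.
exists (Num.min r r') => [|y z]; first by rewrite lt_min r0.
rewrite !lt_min => /andP[y1 y2] /andP[z1 z2].
have -> : f y + g y - (f z + g z) - (L (y - z) + L' (y - z)) =
  (f y - f z - L (y - z)) + (g y - g z - L' (y - z)) by ring.
by rewrite (le_trans (ler_normD _ _)) // (splitr e) mulrDl lerD ?fr ?gr.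
Qed.

Lemma strict_diffM f g x L L' : strict_diff f x L -> strict_diff g x L' ->
  strict_diff (fun y => f y * g y : R) x (fun v => L v * g x + f x * L' v : R).
Proof.
move=> fd gd; have [Cf Cf0 [r1 r10 fl]] := strict_diff_Lipschitz fd.
have [Cg Cg0 [r2 r20 gl]] := strict_diff_Lipschitz gd.
case: fd gd => [[C LC] fL] [[C' LC'] gL]; split=> [|e e0].
  exists (C * `|g x| + `|f x| * C') => v; rewrite (le_trans (ler_normD _ _)) //.
  rewrite !normrM mulrDl lerD //; first by rewrite mulrAC ler_wpM2r.
  by rewrite -mulrA ler_wpM2l.
(* The remainder is split below into four terms, each O(e / A) |y - z|; the
   constant A collects their coefficients. *)
pose A := `|g x| + Cg + 1 + `|C| * Cg + `|f x| + Cf + 1 + Cf * `|C'|.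
have A0 : 0 < A by rewrite /A; have := normr_ge0 (g x); have := normr_ge0 (f x);
  have := mulr_ge0 (normr_ge0 C) (ltW Cg0); have := mulr_ge0 (ltW Cf0) (normr_ge0 C'); lra.
have eA : 0 < e / A by rewrite divr_gt0.
have [r3 r30 fr] := fL _ eA; have [r4 r40 gr] := gL _ eA.
pose r := Num.min (Num.min r1 r2) (Num.min (Num.min r3 r4) (Num.min 1 (e / A))).
exists r => [|y z]; first by rewrite !lt_min r10 r20 r30 r40 ltr01 eA.
rewrite !lt_min => /andP[/andP[y1 y2] /andP[/andP[y3 y4] /andP[y5 y6]]].
move=> /andP[/andP[z1 z2] /andP[/andP[z3 z4] /andP[z5 z6]]].
have x1 : `|x - x| < r1 by rewrite subrr normr0.
have x2 : `|x - x| < r2 by rewrite subrr normr0.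
have hf := fr _ _ y3 z3; have hg := gr _ _ y4 z4.
have gyx := gl _ _ y2 x2; have fzx := fl _ _ z1 x1.
have hL := LC (y - z); have hL' := LC' (y - z).
set n := `|y - z| in hf hg hL hL' *.
have n0 : 0 <= n := normr_ge0 _.
have -> : f y * g y - f z * g z - (L (y - z) * g x + f x * L' (y - z)) =
  (f y - f z - L (y - z)) * g y + L (y - z) * (g y - g x) +
  f z * (g y - g z - L' (y - z)) + (f z - f x) * L' (y - z) by ring.
have gy : `|g y| <= `|g x| + Cg.
  rewrite -[g y](subrK (g x)) (le_trans (ler_normD _ _)) // addrC lerD2l.
  by rewrite (le_trans gyx) // ger_pMr // ltW.
have fz : `|f z| <= `|f x| + Cf.
  rewrite -[f z](subrK (f x)) (le_trans (ler_normD _ _)) // addrC lerD2l.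
  by rewrite (le_trans fzx) // ger_pMr // ltW.
have {}hL : `|L (y - z)| <= `|C| * n.
  by rewrite (le_trans hL) // ler_wpM2r // ler_norm.
have {}hL' : `|L' (y - z)| <= `|C'| * n.
  by rewrite (le_trans hL') // ler_wpM2r // ler_norm.
have t1 : `|(f y - f z - L (y - z)) * g y| <= e / A * n * (`|g x| + Cg).
  by rewrite normrM ler_pM.
have t2 : `|L (y - z) * (g y - g x)| <= `|C| * n * (Cg * (e / A)).
  by rewrite normrM ler_pM // (le_trans gyx) // ler_wpM2l ?ltW.
have t3 : `|f z * (g y - g z - L' (y - z))| <= (`|f x| + Cf) * (e / A * n).
  by rewrite normrM ler_pM.
have t4 : `|(f z - f x) * L' (y - z)| <= Cf * (e / A) * (`|C'| * n).
  by rewrite normrM ler_pM // (le_trans fzx) // ler_wpM2l ?ltW.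
rewrite (le_trans (ler_normD _ _)) //.
have s1 := ler_normD ((f y - f z - L (y - z)) * g y + L (y - z) * (g y - g x))
  (f z * (g y - g z - L' (y - z))).
have s2 := ler_normD ((f y - f z - L (y - z)) * g y) (L (y - z) * (g y - g x)).
have E : e * n = e / A * n * (`|g x| + Cg) + `|C| * n * (Cg * (e / A)) +
   (`|f x| + Cf) * (e / A * n) + Cf * (e / A) * (`|C'| * n) + 2 * (e / A * n).
  by rewrite -[in LHS](divfK (lt0r_neq0 A0) e) {2}/A; ring.
have p : 0 <= e / A * n by rewrite mulr_ge0 // ltW.
by rewrite E; move: s1 s2 t1 t2 t3 t4 p; clear; lra.
Qed.

Lemma strict_diff_sum (I : Type) (s : seq I) (P : pred I) (f L : I -> V -> R) x :
  (forall i, P i -> strict_diff (f i) x (L i)) ->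
  strict_diff (fun y => \sum_(i <- s | P i) f i y : R) x
    (fun v => \sum_(i <- s | P i) L i v : R).
Proof.
move=> fL; elim: s => [|i s IH].
  split; first by exists 0 => v; rewrite big_nil normr0 mul0r.
  by move=> e e0; exists 1 => // y z _ _; rewrite !big_nil !subr0 normr0 mulr_ge0 // ltW.
have -> : (fun y => \sum_(i <- i :: s | P i) f i y) =
  if P i then (fun y => f i y + \sum_(i <- s | P i) f i y) else
    (fun y => \sum_(i <- s | P i) f i y).
  by apply/funext => y; rewrite big_cons; case: ifP.
have -> : (fun v => \sum_(i <- i :: s | P i) L i v) =
  if P i then (fun y => L i y + \sum_(i <- s | P i) L i y) else
    (fun y => \sum_(i <- s | P i) L i y).
  by apply/funext => y; rewrite big_cons; case: ifP.
by case: ifP => // Pi; apply: strict_diffD => //; exact: fL.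
Qed.

Lemma strict_diff_scale (c : R) f x L : strict_diff f x L ->
  strict_diff (fun y => c * f y : R) x (fun v => c * L v : R).
Proof.
move=> fd; have := strict_diffM (strict_diff_cst c x) fd.
by congr strict_diff; apply/funext => v; rewrite mul0r add0r.
Qed.

End RealValued.

Lemma strict_diff_comp (V W : normedModType R) (f : V -> W) (g : W -> R)
    (x : V) (L : V -> W) (L' : W -> R) :
  (forall u v, L' (u - v) = L' u - L' v) ->
  strict_diff f x L -> strict_diff g (f x) L' ->
  strict_diff (g \o f) x (L' \o L).
Proof.
move=> L'B fd; have [Cf Cf0 [r1 r10 fl]] := strict_diff_Lipschitz fd.
case: fd => [[C LC] fL] [[C' LC'] gL]; split=> [|e e0].
  exists (`|C'| * C) => v; rewrite (le_trans (LC' _)) // -mulrA.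
  apply: (@le_trans _ _ (`|C'| * `|L v|)).
    by rewrite ler_wpM2r // ler_norm.
  by rewrite ler_wpM2l.
have C'1 : 0 < 2 * (`|C'| + 1) by rewrite mulr_gt0 // ltr_wpDl.
have Cf1 : 0 < 2 * Cf by rewrite mulr_gt0.
have [r2 r20 fr] := fL _ (divr_gt0 e0 C'1); have [r3 r30 gr] := gL _ (divr_gt0 e0 Cf1).
exists (Num.min (Num.min r1 r2) (r3 / Cf)) => [|y z].
  by rewrite !lt_min r10 r20 divr_gt0.
rewrite !lt_min => /andP[/andP[y1 y2] y3] /andP[/andP[z1 z2] z3] /=.
have x1 : `|x - x| < r1 by rewrite subrr normr0.
have hy : `|f y - f x| < r3.
  by rewrite (le_lt_trans (fl _ _ y1 x1)) // mulrC -ltr_pdivlMr.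
have hz : `|f z - f x| < r3.
  by rewrite (le_lt_trans (fl _ _ z1 x1)) // mulrC -ltr_pdivlMr.
have h1 := gr _ _ hy hz; have h2 := fr _ _ y2 z2; have h3 := fl _ _ y1 z1.
have h4 := LC' (f y - f z - L (y - z)); rewrite L'B in h4.
have -> : g (f y) - g (f z) - L' (L (y - z)) =
  (g (f y) - g (f z) - L' (f y - f z)) + (L' (f y - f z) - L' (L (y - z))) by ring.
rewrite (le_trans (ler_normD _ _)) //.
have h5 : e / (2 * Cf) * `|f y - f z| <= e / 2 * `|y - z|.
  have -> : e / 2 * `|y - z| = e / (2 * Cf) * (Cf * `|y - z|).
    by field; rewrite gt_eqF.
  by rewrite ler_wpM2l // ltW // divr_gt0.
have h6 : C' * `|f y - f z - L (y - z)| <= e / 2 * `|y - z|.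
  have p : 0 < `|C'| + 1 by rewrite ltr_wpDl.
  apply: (@le_trans _ _ ((`|C'| + 1) * `|f y - f z - L (y - z)|)).
    by rewrite ler_wpM2r // (le_trans (ler_norm _)) // lerDl.
  have -> : e / 2 * `|y - z| = (`|C'| + 1) * (e / (2 * (`|C'| + 1)) * `|y - z|).
    by field; rewrite gt_eqF.
  by rewrite ler_pM2l.
lra.
Qed.

(** By the mean value theorem, a C^1 function is strictly differentiable. *)
Lemma strict_diff_C1 (g g' : R -> R) (x a : R) : a < x ->
  (forall t, a < t -> is_derive t 1 g (g' t)) -> {for x, continuous g'} ->
  strict_diff g x (fun h => g' x * h : R).
Proof.
move=> ax dg cg; split=> [|e e0].
  by exists `|g' x| => v; rewrite normrM.
have /cvgrPdist_lt /(_ e e0) [r /= r0 rP] := cg.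
exists (Num.min r (x - a)) => [|y z]; first by rewrite lt_min r0 subr_gt0.
wlog yz : y z / z <= y.
  move=> wl; have [zy|/ltW yz] := leP z y; first exact: wl.
  move=> yr zr; have := wl z y yz zr yr.
  by rewrite -normrN distrC; congr (_ <= _); congr (`|_|); ring.
rewrite !lt_min => /andP[y1 y2] /andP[z1 z2].
have za : a < z by move: z2; rewrite ltr_norml => /andP[? _]; lra.
have dzy t : t \in `]z, y[ -> is_derive t 1 g (g' t).
  by rewrite in_itv /= => /andP[zt _]; exact: dg (lt_trans za zt).
have czy : {within `[z, y], continuous g}.
  apply: continuous_in_subspaceT => t; rewrite inE /= in_itv /= => /andP[zt _].
  exact: is_derive_continuous (dg _ (lt_le_trans za zt)).
have [c] := MVT_segment yz dzy czy.
rewrite in_itv /= => /andP[zc cy] ->.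
rewrite -mulrBl normrM ler_wpM2r // distrC ltW // rP //=.
move: y1 z1; rewrite !ltr_norml => /andP[? ?] /andP[? ?]; apply/andP; split; lra.
Qed.

Lemma strict_diff_mx (V : normedModType R) (p q : nat) (f L : V -> 'M[R]_(p, q)) (x : V) :
  (forall j i, strict_diff (fun y => f y j i : R) x (fun v => L v j i : R)) ->
  strict_diff f x L.
Proof.
move=> fL; split=> [|e e0].
  have /choice[C hC] : forall ji : 'I_p * 'I_q, exists C, forall v,
      `|L v ji.1 ji.2| <= C * `|v|.
    by move=> [j i]; have [] := fL j i.
  exists (\sum_ji `|C ji|) => v; apply: norm_le_coord => [|j i].
    by rewrite mulr_ge0 // sumr_ge0.
  rewrite (le_trans (hC (j, i) v)) // ler_wpM2r // (le_trans (ler_norm _)) //.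
  by rewrite (bigD1 (j, i)) //= lerDl sumr_ge0.
have /choice[r hr] : forall ji : 'I_p * 'I_q, exists r, 0 < r /\ forall y z,
   `|y - x| < r -> `|z - x| < r ->
   `|f y ji.1 ji.2 - f z ji.1 ji.2 - L (y - z) ji.1 ji.2| <= e * `|y - z|.
  by move=> [j i]; have [_ /(_ e e0)[r r0 h]] := fL j i; exists r.
have [r0 r00 r0r] := common_radius (fun ji => (hr ji).1).
exists r0 => // y z yr zr; apply: norm_le_coord => [|j i].
  by rewrite mulr_ge0 // ltW.
by rewrite !mxE; apply: (hr (j, i)).2; apply: lt_le_trans (r0r _).
Qed.

End StrictDiff.

(** * The Kepler force *)

Section Kepler.
Context {R : realType} {k : nat}.
Implicit Types (q u v w : 'rV[R]_k) (c : R).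

Lemma dotvC u v : dotv u v = dotv v u.
Proof. by apply: eq_bigr => i _; rewrite mulrC. Qed.

Lemma dotvDl u v w : dotv (u + v) w = dotv u w + dotv v w.
Proof. by rewrite -big_split; apply: eq_bigr => i _; rewrite mxE mulrDl. Qed.

Lemma dotvZl c u w : dotv (c *: u) w = c * dotv u w.
Proof. by rewrite mulr_sumr; apply: eq_bigr => i _; rewrite mxE mulrA. Qed.

Lemma dotvNl u w : dotv (- u) w = - dotv u w.
Proof. by rewrite -scaleN1r dotvZl mulN1r. Qed.

Lemma dotvBl u v w : dotv (u - v) w = dotv u w - dotv v w.
Proof. by rewrite dotvDl dotvNl. Qed.

Lemma dotvDr u v w : dotv w (u + v) = dotv w u + dotv w v.
Proof. by rewrite dotvC dotvDl !(dotvC w). Qed.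

Lemma dotvZr c u w : dotv w (c *: u) = c * dotv w u.
Proof. by rewrite dotvC dotvZl (dotvC w). Qed.

Lemma dotvNr u w : dotv w (- u) = - dotv w u.
Proof. by rewrite dotvC dotvNl (dotvC w). Qed.

Lemma dotvBr u v w : dotv w (u - v) = dotv w u - dotv w v.
Proof. by rewrite dotvDr dotvNr. Qed.

Lemma dotv_suml (I : Type) (s : seq I) (P : pred I) (F : I -> 'rV[R]_k) w :
  dotv (\sum_(i <- s | P i) F i) w = \sum_(i <- s | P i) dotv (F i) w.
Proof.
elim/big_rec2: _ => [|i x y _ <-]; last by rewrite dotvDl.
by rewrite /dotv big1 // => i _; rewrite mxE mul0r.
Qed.

Lemma dotvv_gt0 q : q != 0 -> 0 < dotv q q.
Proof.
move=> q0; have p0 (i : 'I_k) : 0 <= q 0 i * q 0 i by rewrite -expr2 sqr_ge0.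
rewrite lt_def sumr_ge0 // andbT; apply: contra q0 => /eqP q0.
apply/eqP/rowP => i; rewrite mxE; apply/eqP; rewrite -sqrf_eq0 expr2.
by move: q0 => /psumr_eq0P -> .
Qed.

Lemma enorm_gt0 q : q != 0 -> 0 < enorm q.
Proof. by move=> q0; rewrite sqrtr_gt0 dotvv_gt0. Qed.

Lemma enorm_neq0 q : q != 0 -> enorm q != 0.
Proof. by move=> /enorm_gt0 h; rewrite gt_eqF. Qed.

Lemma sqr_enorm q : enorm q ^+ 2 = dotv q q.
Proof.
by rewrite sqr_sqrtr // sumr_ge0 // => i _; rewrite -expr2 sqr_ge0.
Qed.

Lemma enormZ c q : enorm (c *: q) = `|c| * enorm q.
Proof. by rewrite /enorm dotvZl dotvZr mulrA -expr2 sqrtrM ?sqr_ge0 // sqrtr_sqr. Qed.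

Lemma enormN q : enorm (- q) = enorm q.
Proof. by rewrite -scaleN1r enormZ normrN1 mul1r. Qed.

Lemma norm_le_enorm q : `|q| <= enorm q.
Proof.
apply: norm_le_coord => [|j i]; first exact: sqrtr_ge0.
rewrite ord1 -sqrtr_sqr ler_wsqrtr // /dotv (bigD1 i) //= -expr2 lerDl.
by apply: sumr_ge0 => l _; rewrite -expr2 sqr_ge0.
Qed.

(** The attraction of a unit mass at the origin, up to sign.  This definition and
    that of its differential are locked: otherwise unification compares
    them at different points by unfolding down to the entries. *)
Definition kepler q := locked ((enorm q ^+ 3)^-1 *: q).

Lemma keplerE q : kepler q = (enorm q ^+ 3)^-1 *: q.
Proof. by rewrite /kepler -lock. Qed.

Definition dkepler q v :=
  locked ((enorm q ^+ 3)^-1 *: v - (3 * dotv q v / enorm q ^+ 5) *: q).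

Lemma dkeplerE q v : dkepler q v =
  (enorm q ^+ 3)^-1 *: v - (3 * dotv q v / enorm q ^+ 5) *: q.
Proof. by rewrite /dkepler -lock. Qed.

Lemma keplerN q : kepler (- q) = - kepler q.
Proof. by rewrite !keplerE enormN scalerN. Qed.

Lemma keplerZ c q : 0 < c -> kepler (c *: q) = (c ^+ 2)^-1 *: kepler q.
Proof.
move=> c0; have c0' : c != 0 by rewrite gt_eqF.
rewrite !keplerE enormZ gtr0_norm // !scalerA exprMn invfM; congr (_ *: _).
by rewrite mulrAC; congr (_ * _); field.
Qed.

Lemma dotv_kepler q : dotv (kepler q) q = (enorm q)^-1.
Proof.
rewrite keplerE dotvZl -sqr_enorm; have [->|e0] := eqVneq (enorm q) 0.
  by rewrite !expr0n /= mulr0 invr0.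
by field.
Qed.

Lemma dkeplerD q u v : dkepler q (u + v) = dkepler q u + dkepler q v.
Proof. by rewrite !dkeplerE dotvDr mulrDr mulrDl scalerDl scalerDr opprD addrACA. Qed.

Lemma dkeplerZ q c v : dkepler q (c *: v) = c *: dkepler q v.
Proof.
rewrite !dkeplerE dotvZr scalerBr !scalerA; congr (_ *: _ - _ *: _); ring.
Qed.

Lemma dkeplerN q v : dkepler q (- v) = - dkepler q v.
Proof. by rewrite -scaleN1r dkeplerZ scaleN1r. Qed.

Lemma dkepler_opp q v : dkepler (- q) v = dkepler q v.
Proof. by rewrite !dkeplerE enormN dotvNl mulrN mulNr scalerN scaleNr opprK. Qed.

(** Euler's identity, the Kepler force being homogeneous of degree -2. *)
Lemma dkepler_self q : q != 0 -> dkepler q q = - 2 *: kepler q.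
Proof.
move=> /enorm_neq0 q0; rewrite dkeplerE keplerE -sqr_enorm -scalerBl scalerA.
by congr (_ *: _); field.
Qed.

Lemma dkepler_sym q u v : dotv (dkepler q u) v = dotv (dkepler q v) u.
Proof. rewrite !dkeplerE !dotvBl !dotvZl (dotvC u v); ring. Qed.

Lemma strict_diff_coord (i : 'I_k) q :
  strict_diff (fun v => v 0 i) q (fun v : 'rV[R]_k => v 0 i).
Proof.
apply: strict_diff_linear => [y z|]; first by rewrite !mxE.
by exists 1 => v; rewrite mul1r coord_le_norm.
Qed.

Lemma strict_diff_invsqrt (x : R) : 0 < x ->
  strict_diff (fun t => (Num.sqrt t)^-1) x
    (fun h => - 2^-1 * (Num.sqrt x)^-1 ^+ 3 * h : R).
Proof.
move=> x0; have dg (t : R) : 0 < t -> is_derive t 1 (fun t => (Num.sqrt t)^-1 : R)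
    (- 2^-1 * (Num.sqrt t)^-1 ^+ 3).
  move=> t0; have s0 : Num.sqrt t != 0 by rewrite gt_eqF // sqrtr_gt0.
  apply: is_derive_eq (is_deriveV s0 (is_derive1_sqrt t0)) _.
  by rewrite /GRing.scale /=; field.
apply: (@strict_diff_C1 _ _ (fun t => - 2^-1 * (Num.sqrt t)^-1 ^+ 3) _ 0) => //.
have c := is_derive_continuous (dg x x0).
apply: cvgM; first exact: cvg_cst.
exact: cvgM c (cvgM c c).
Qed.

Lemma strict_diff_invnorm q : q != 0 ->
  strict_diff (fun q => (enorm q)^-1 : R) q
    (fun v => - (dotv q v * (enorm q)^-1 ^+ 3) : R).
Proof.
move=> q0.
have d1 : strict_diff (fun q => dotv q q : R) q (fun v => 2 * dotv q v : R).
  have := @strict_diff_sum R 'rV[R]_k _ (index_enum 'I_k) xpredT _ _ q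
    (fun i _ => strict_diffM (strict_diff_coord i q) (strict_diff_coord i q)).
  congr strict_diff; apply/funext => v; rewrite mulr_sumr.
  by apply: eq_bigr => i _; ring.
have := strict_diff_comp _ d1 (strict_diff_invsqrt (dotvv_gt0 q0)).
have E : (fun h : R => - 2^-1 * (Num.sqrt (dotv q q))^-1 ^+ 3 * h) \o
  (fun v => 2 * dotv q v) = (fun v => - (dotv q v * (enorm q)^-1 ^+ 3)).
  by apply/funext => v /=; rewrite /enorm; field; rewrite gt_eqF // sqrtr_gt0 dotvv_gt0.
by rewrite E; apply => u v; rewrite mulrBr.
Qed.

Lemma strict_diff_kepler q : q != 0 -> strict_diff kepler q (dkepler q).
Proof.
move=> q0; have e0 := enorm_neq0 q0; apply: strict_diff_mx => j i; rewrite ord1.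
have dN := strict_diff_invnorm q0.
have := strict_diffM (strict_diffM dN (strict_diffM dN dN)) (strict_diff_coord i q).
congr strict_diff.
  by apply/funext => v; rewrite keplerE mxE !exprS expr0 mulr1 !invfM.
by apply/funext => v; rewrite dkeplerE !mxE; field.
Qed.

End Kepler.

(** * The force of centres at the origin, as a gradient *)

Section Forces.
Context {R : realType} {H k : nat}.
Variable (m : 'I_H -> R).
Hypothesis hm : forall j, 0 < m j.
Local Notation V := 'M[R]_(H, k).
Local Notation rV := 'rV[R]_k.
Implicit Types (y z u v xi : V) (p : 'I_H -> rV) (f : 'I_H -> 'I_H -> rV).

Lemma norm_row_le y j : `|row j y| <= `|y|.
Proof. by apply: norm_le_coord => // i l; rewrite mxE coord_le_norm. Qed.

Lemma norm_le_rows y (C : R) : 0 <= C -> (forall j, `|row j y| <= C) -> `|y| <= C.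
Proof.
move=> C0 h; apply: norm_le_coord => // j i.
by apply: le_trans (h j); have := coord_le_norm (row j y) 0 i; rewrite mxE.
Qed.

Lemma rowD j u v : row j (u + v) = row j u + row j v.
Proof. by apply/rowP => i; rewrite !mxE. Qed.

Lemma rowZ j (c : R) u : row j (c *: u) = c *: row j u.
Proof. by apply/rowP => i; rewrite !mxE. Qed.

Lemma rowB j u v : row j (u - v) = row j u - row j v.
Proof. by apply/rowP => i; rewrite !mxE. Qed.

Lemma sum_ordered_pairs (A : 'I_H -> 'I_H -> R) :
  \sum_j \sum_(l | l != j) A j l = \sum_(j < H) \sum_(l < H | (l < j)%N) (A j l + A l j).
Proof.
under [RHS]eq_bigr do rewrite big_split /=.
rewrite big_split /= [X in _ = _ + X](exchange_big_dep xpredT) //= -big_split.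
apply: eq_bigr => j _ /=; rewrite (bigID (fun l : 'I_H => (l < j)%N)) /=.
by congr (_ + _); apply: eq_bigl => l; rewrite -val_eqE /=; case: ltngtP.
Qed.

(** Accelerations produced by an external force p_j on each body and by mutual
    forces f_(j,l) proportional to the mass of the source.  The field, its
    differential and its perturbations all have this form, and share the
    symmetrization below. *)
Definition pair_field p f : V :=
  locked (\matrix_j (- p j - \sum_(l | l != j) m l *: f j l)).

Lemma row_pair_field p f j :
  row j (pair_field p f) = - p j - \sum_(l | l != j) m l *: f j l.
Proof. by rewrite /pair_field -lock rowK. Qed.

(** Action and reaction: with the weights m_j, the mutual forces pair up into
    terms that see only the relative displacements v_l - v_j. *)
Lemma mdot_pair_field p f v : (forall j l, f j l = - f l j) ->
  mdot m (pair_field p f) v = - (\sum_j m j * dotv (p j) (row j v))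
    - \sum_(j < H) \sum_(l < H | (l < j)%N) m l * m j * dotv (f l j) (row l v - row j v).
Proof.
move=> fN.
have -> : \sum_(j < H) \sum_(l < H | (l < j)%N) m l * m j * dotv (f l j) (row l v - row j v)
  = \sum_j \sum_(l | l != j) m j * m l * dotv (f j l) (row j v).
  rewrite sum_ordered_pairs; do 2! apply: eq_bigr => ? _.
  by rewrite dotvBr [in RHS]fN dotvNl; ring.
rewrite -!sumrN -big_split; apply: eq_bigr => j _ /=.
rewrite row_pair_field dotvBl dotvNl dotv_suml mulrBr mulrN.
congr (_ - _); rewrite mulr_sumr; apply: eq_bigr => l _; rewrite dotvZl; ring.
Qed.

Lemma pair_field_linear (c : R) p f p' f' :
  pair_field (fun j => c *: p j + p' j) (fun j l => c *: f j l + f' j l) =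
  c *: pair_field p f + pair_field p' f'.
Proof.
apply/row_matrixP => j; rewrite rowD rowZ !row_pair_field.
have -> : \sum_(l | l != j) m l *: (c *: f j l + f' j l) =
    c *: (\sum_(l | l != j) m l *: f j l) + \sum_(l | l != j) m l *: f' j l.
  rewrite scaler_sumr -big_split; apply: eq_bigr => l _ /=.
  by rewrite scalerDr !scalerA mulrC.
move: (bigop _ _ _) (bigop _ _ _) (p j) (p' j) => S T A B.
by apply/rowP => i; rewrite !mxE; ring.
Qed.

(** The gradient of the potential for the mass scalar product. *)
Definition gforce (mt : R) y : V := pair_field (fun j => mt *: kepler (row j y))
  (fun j l => kepler (row j y - row l y)).

(** The differential of [gforce] at y. *)
Definition dforce (mt : R) y v : V :=
  pair_field (fun j => mt *: dkepler (row j y) (row j v))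
    (fun j l => dkepler (row j y - row l y) (row j v - row l v)).

Lemma kepler_antisym y j l :
  kepler (row j y - row l y) = - kepler (row l y - row j y).
Proof. by rewrite -keplerN opprB. Qed.

Lemma dkepler_antisym y v j l : dkepler (row j y - row l y) (row j v - row l v) =
  - dkepler (row l y - row j y) (row l v - row j v).
Proof. by rewrite -dkeplerN -(dkepler_opp (row l y - row j y)) !opprB. Qed.

(** Euler's identity for a potential homogeneous of degree -1. *)
Lemma Euler_potential (mt : R) y : mdot m (gforce mt y) y = - potential mt m y.
Proof.
rewrite mdot_pair_field; last exact: kepler_antisym.
rewrite /potential opprD mulr_sumr; congr (- _ - _); apply: eq_bigr => j _.
  by rewrite dotvZl dotv_kepler; ring.
by apply: eq_bigr => l _; rewrite dotv_kepler.
Qed.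

Lemma row_dforce (mt : R) y v j : row j (dforce mt y v) =
  - (mt *: dkepler (row j y) (row j v)) -
  \sum_(l | l != j) m l *: dkepler (row j y - row l y) (row j v - row l v).
Proof. exact: row_pair_field. Qed.

Lemma row_gforce (mt : R) y j : row j (gforce mt y) =
  - (mt *: kepler (row j y)) - \sum_(l | l != j) m l *: kepler (row j y - row l y).
Proof. exact: row_pair_field. Qed.

Lemma dforce_linear (mt : R) y c u v :
  dforce mt y (c *: u + v) = c *: dforce mt y u + dforce mt y v.
Proof.
rewrite /dforce -pair_field_linear; congr (pair_field _ _).
  apply/funext => j; rewrite (rowD j (c *: u) v) (rowZ j c u).
  by rewrite (dkeplerD _ (c *: row j u)) (dkeplerZ _ c) scalerDr !scalerA mulrC.
apply/funext => j; apply/funext => l.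
have -> : row j (c *: u + v) - row l (c *: u + v) =
    c *: (row j u - row l u) + (row j v - row l v).
  rewrite (rowD l (c *: u) v) (rowZ l c u) (rowD j (c *: u) v) (rowZ j c u).
  by rewrite scalerBr opprD addrACA.
by rewrite (dkeplerD _ (c *: _)) (dkeplerZ _ c).
Qed.

Lemma dforceB (mt : R) y u v : dforce mt y (u - v) = dforce mt y u - dforce mt y v.
Proof.
have -> : u - v = (-1) *: v + u by rewrite scaleN1r addrC.
by rewrite dforce_linear scaleN1r addrC.
Qed.

Lemma dforceZ (mt : R) y c u : dforce mt y (c *: u) = c *: dforce mt y u.
Proof.
have := dforceB mt y 0 0; rewrite !subrr => d0.
by rewrite -[c *: u]addr0 dforce_linear d0 addr0.
Qed.

(** The differential of a gradient is self-adjoint. *)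
Lemma dforce_sym (mt : R) y u v : mdot m (dforce mt y u) v = mdot m (dforce mt y v) u.
Proof.
rewrite [LHS](mdot_pair_field _ _ (dkepler_antisym y u)).
rewrite [RHS](mdot_pair_field _ _ (dkepler_antisym y v)).
congr (- _ - _); apply: eq_bigr => j _.
  by rewrite !dotvZl dkepler_sym.
by apply: eq_bigr => l _; rewrite dkepler_sym.
Qed.

(** Euler's identity for a field homogeneous of degree -2. *)
Lemma dforce_self (mt : R) y : Sigma y -> dforce mt y y = - 2 *: gforce mt y.
Proof.
move=> [y0 yy]; apply/row_matrixP => j.
rewrite (rowZ j _ (gforce mt y)) row_dforce row_gforce.
rewrite scalerBr scalerN; congr (- _ - _).
  by rewrite dkepler_self // !scalerA mulrC.
rewrite scaler_sumr; apply: eq_bigr => l lj.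
by rewrite dkepler_self ?scalerA 1?mulrC // subr_eq0 yy // eq_sym.
Qed.

Lemma linear_bounded (L : V -> V) :
  (forall c u v, L (c *: u + v) = c *: L u + L v) ->
  exists C, forall v, `|L v| <= C * `|v|.
Proof.
move=> Ll.
have L0 : L 0 = 0.
  by apply: (@addrI _ (L 0)); rewrite -{1}[L 0]scale1r -Ll !addr0 scaler0.
exists (\sum_j \sum_i `|L (delta_mx j i)|) => v.
have Lsum (I : Type) (s : seq I) (F : I -> V) :
    L (\sum_(i <- s) F i) = \sum_(i <- s) L (F i).
  elim: s => [|i s IH]; first by rewrite !big_nil.
  by rewrite !big_cons -[F i]scale1r Ll !scale1r IH.
rewrite {1}[v]matrix_sum_delta Lsum mulr_suml.
rewrite (le_trans (ler_norm_sum _ _ _)) //; apply: ler_sum => j _.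
rewrite Lsum mulr_suml (le_trans (ler_norm_sum _ _ _)) //.
apply: ler_sum => i _; rewrite -[_ *: _]addr0 Ll L0 addr0 normrZ mulrC.
by rewrite ler_wpM2l // coord_le_norm.
Qed.

Lemma strict_diff_row j y : strict_diff (row j) y (row j : V -> rV).
Proof.
apply: strict_diff_mx => i l.
apply: strict_diff_linear => [u v|]; first by rewrite !mxE.
exists 1 => v; rewrite mul1r (le_trans _ (norm_row_le v j)) //.
exact: coord_le_norm.
Qed.

Lemma strict_diff_rowB j l y :
  strict_diff (fun y => row l y - row j y) y (fun v => row l v - row j v : rV).
Proof.
apply: strict_diff_mx => a i.
apply: strict_diff_linear => [u v|]; first by rewrite !mxE; ring.
exists 2 => v; rewrite !mxE (le_trans (ler_normB _ _)) //.
by have := coord_le_norm v l i; have := coord_le_norm v j i; lra.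
Qed.

Lemma strict_diff_potential (mt : R) y : Sigma y ->
  strict_diff (potential mt m) y (mdot m (gforce mt y)).
Proof.
move=> [y0 yy].
have dN j : strict_diff (fun y : V => (enorm (row j y))^-1 : R) y
    (fun v : V => - dotv (kepler (row j y)) (row j v) : R).
  have := strict_diff_comp _ (strict_diff_row j y) (strict_diff_invnorm (y0 j)).
  move=> h; have /h : forall u v : rV,
      - (dotv (row j y) (u - v) * (enorm (row j y))^-1 ^+ 3) =
      - (dotv (row j y) u * (enorm (row j y))^-1 ^+ 3)
      - - (dotv (row j y) v * (enorm (row j y))^-1 ^+ 3).
    by move=> u v; rewrite dotvBr; ring.
  by congr strict_diff; apply/funext => v /=; rewrite keplerE dotvZl exprVn mulrC.
have dNN j l : l != j -> strict_diff (fun y : V => (enorm (row l y - row j y))^-1 : R) y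
    (fun v : V => - dotv (kepler (row l y - row j y)) (row l v - row j v) : R).
  move=> lj; have ylj : row l y - row j y != 0 by rewrite subr_eq0 yy.
  have := strict_diff_comp _ (strict_diff_rowB j l y) (strict_diff_invnorm ylj).
  move=> h; have /h : forall u v : rV,
      - (dotv (row l y - row j y) (u - v) * (enorm (row l y - row j y))^-1 ^+ 3) =
      - (dotv (row l y - row j y) u * (enorm (row l y - row j y))^-1 ^+ 3)
      - - (dotv (row l y - row j y) v * (enorm (row l y - row j y))^-1 ^+ 3).
    by move=> u v; rewrite dotvBr; ring.
  by congr strict_diff; apply/funext => v /=; rewrite keplerE dotvZl exprVn mulrC.
have := strict_diffD (strict_diff_scale mt (strict_diff_sum (index_enum 'I_H)
    (P := xpredT) (fun j _ => strict_diff_scale (m j) (dN j))))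
  (strict_diff_sum (index_enum 'I_H) (P := xpredT) (fun j _ =>
   strict_diff_sum (index_enum 'I_H) (P := fun l : 'I_H => (l < j)%N)
   (fun l lj => strict_diff_scale (m l * m j) (dNN j l (negbT (ltn_eqF lj)))))).
congr strict_diff; apply/funext => v.
rewrite mdot_pair_field; last exact: kepler_antisym.
rewrite mulr_sumr -!sumrN; congr (_ + _); apply: eq_bigr => j _.
  by rewrite dotvZl; ring.
by rewrite -sumrN; apply: eq_bigr => l _; ring.
Qed.

Lemma derive_potential (mt : R) y v : Sigma y ->
  'D_v (potential mt m) y = mdot m (gforce mt y) v.
Proof.
move=> yS; have LZ c u : mdot m (gforce mt y) (c *: u) = c *: mdot m (gforce mt y) u.
  by rewrite mdotZr.
by case: (strict_diff_is_derive v LZ (strict_diff_potential mt yS)).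
Qed.

Lemma mgrad_potential (mt : R) y : Sigma y -> mgrad m (potential mt m) y = gforce mt y.
Proof.
move=> yS; apply/matrixP => j i; rewrite mxE derive_potential // mdotE.
rewrite (bigD1 j) //= (bigD1 i) //= !mxE !eqxx mulr1 big1 => [|l lj]; last first.
  by rewrite !mxE (negPf lj) andbF !mulr0.
rewrite big1 => [|l lj]; first by rewrite !addr0 mulrA mulVf ?mul1r // gt_eqF.
by rewrite big1 // => a _; rewrite !mxE (negPf lj) !mulr0.
Qed.

End Forces.

(** * Perturbed centres, and the Hessian on the sphere *)

Section ShiftedForces.
Context {R : realType} {H k N : nat}.
Variables (m : 'I_H -> R) (mt : 'I_N -> R).
Hypothesis hm : forall j, 0 < m j.
Local Notation V := 'M[R]_(H, k).
Local Notation rV := 'rV[R]_k.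
Implicit Types (y z u v xi : V) (b : 'I_N -> rV).

(** The acceleration field when the centres sit at the points b_n. *)
Definition force b y : V :=
  pair_field m (fun j => \sum_n mt n *: kepler (row j y - b n))
    (fun j l => kepler (row j y - row l y)).

Lemma row_force b y j : row j (force b y) =
  - (\sum_n mt n *: kepler (row j y - b n)) -
  \sum_(l | l != j) m l *: kepler (row j y - row l y).
Proof. exact: row_pair_field. Qed.

Lemma force0 y : force (fun=> 0) y = gforce m (\sum_n mt n) y.
Proof.
congr (pair_field _ _ _); apply/funext => j; rewrite scaler_suml.
by apply: eq_bigr => n _; rewrite subr0.
Qed.

Lemma Sigma_gap xi : Sigma xi -> exists2 r, 0 < r & forall y b,
  `|y - xi| < r -> (forall n, `|b n| < r) ->
  (forall j n, row j y != b n) /\ (forall l j, l != j -> row l y != row j y).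
Proof.
move=> [x0 xx].
pose d1 j := `|row j xi|.
pose d2 (p : 'I_H * 'I_H) := if p.1 != p.2 then `|row p.1 xi - row p.2 xi| else 1.
have d10 j : 0 < d1 j by rewrite normr_gt0.
have d20 p : 0 < d2 p.
  by rewrite /d2; case: ifP => // pp; rewrite normr_gt0 subr_eq0 xx.
have [r1 r10 h1] := common_radius d10; have [r2 r20 h2] := common_radius d20.
exists (Num.min r1 r2 / 2) => [|y b]; first by rewrite divr_gt0 // lt_min r10.
set r := Num.min r1 r2 / 2 => yr br.
have rr1 : r + r <= r1 by rewrite /r -splitr ge_min lexx.
have rr2 : r + r <= r2 by rewrite /r -splitr ge_min lexx orbT.
have ry j : `|row j xi - row j y| < r.
  by rewrite -rowB (le_lt_trans (norm_row_le _ _)) // distrC.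
split=> [j n|l j lj]; apply/eqP => E.
  have := h1 j; apply/negP; rewrite -ltNge (lt_le_trans _ rr1) //.
  rewrite /d1 -[row j xi](subrK (row j y)) (le_lt_trans (ler_normD _ _)) //.
  by rewrite ltrD // E.
have := h2 (l, j); apply/negP; rewrite -ltNge (lt_le_trans _ rr2) // /d2 /= lj.
have -> : row l xi - row j xi = (row l xi - row l y) - (row j xi - row j y).
  by rewrite E opprB addrA subrK.
by rewrite (le_lt_trans (ler_normB _ _)) // ltrD.
Qed.

Lemma row_force_remainder b xi y z u j :
  row j (force b y - force b z - dforce m (\sum_n mt n) xi u) =
  - (\sum_n mt n *: (kepler (row j y - b n) - kepler (row j z - b n)
                     - dkepler (row j xi) (row j u)))
  - \sum_(l | l != j) m l *: (kepler (row j y - row l y) - kepler (row j z - row l z)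
                     - dkepler (row j xi - row l xi) (row j u - row l u)).
Proof.
rewrite (rowB j (force b y - force b z)) (rowB j (force b y)) row_dforce !row_force.
under [X in _ = - X - _]eq_bigr do rewrite !scalerBr.
under [X in _ = _ - X]eq_bigr do rewrite !scalerBr.
rewrite !sumrB -scaler_suml.
move: (_ *: dkepler _ _) (bigop _ _ _) (bigop _ _ _) (bigop _ _ _) => D.
move: (bigop _ _ _) (bigop _ _ _) => S1 S2 S3 S4 S5.
by apply/rowP => i; rewrite !mxE; ring.
Qed.

(** Moving a centre by b_n only translates the argument of a Kepler force, so
    strict differentiability at the differences of the row vectors of xi yields
    a radius that serves all small b at once. *)
Lemma force_strict xi : Sigma xi -> forall e, 0 < e ->
  exists2 r, 0 < r & forall y z b, `|y - xi| < r -> `|z - xi| < r ->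
    (forall n, `|b n| < r) ->
    `|force b y - force b z - dforce m (\sum_n mt n) xi (y - z)| <= e * `|y - z|.
Proof.
move=> [x0 xx] e e0.
pose A := 1 + \sum_n `|mt n| + \sum_l 2 * m l.
have A0 : 0 < A.
  rewrite ltr_pwDl ?ltr_pwDl ?sumr_ge0 // => l _; rewrite mulr_ge0 //; exact: ltW.
have eA : 0 < e / A by rewrite divr_gt0.
have /choice[r1 h1] : forall j, exists r, 0 < r /\ forall q q' : rV,
    `|q - row j xi| < r -> `|q' - row j xi| < r ->
    `|kepler q - kepler q' - dkepler (row j xi) (q - q')| <= e / A * `|q - q'|.
  by move=> j; have [_ /(_ _ eA)[r r0 h]] := strict_diff_kepler (x0 j); exists r.
have /choice[r2 h2] : forall p : 'I_H * 'I_H, exists r, 0 < r /\ (p.2 != p.1 ->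
    forall q q' : rV, `|q - (row p.1 xi - row p.2 xi)| < r ->
    `|q' - (row p.1 xi - row p.2 xi)| < r ->
    `|kepler q - kepler q' - dkepler (row p.1 xi - row p.2 xi) (q - q')|
      <= e / A * `|q - q'|).
  move=> [j l] /=; have [->|lj] := eqVneq l j; first by exists 1.
  have q0 : row j xi - row l xi != 0 by rewrite subr_eq0 xx // eq_sym.
  by have [_ /(_ _ eA)[r r0 h]] := strict_diff_kepler q0; exists r.
have [s1 s10 k1] := common_radius (fun j => (h1 j).1).
have [s2 s20 k2] := common_radius (fun p => (h2 p).1).
exists (Num.min s1 s2 / 2) => [|y z b]; first by rewrite divr_gt0 // lt_min s10.
set r := Num.min s1 s2 / 2 => yr zr br.
have rr1 : r + r <= s1 by rewrite /r -splitr ge_min lexx.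
have rr2 : r + r <= s2 by rewrite /r -splitr ge_min lexx orbT.
have ry w j : `|w - xi| < r -> `|row j w - row j xi| < r.
  by move=> wr; rewrite -rowB (le_lt_trans (norm_row_le _ _)).
apply: norm_le_rows => [|j]; first by rewrite mulr_ge0 // ltW.
rewrite row_force_remainder (le_trans (ler_normB _ _)) // normrN.
have n0 := normr_ge0 (y - z).
apply: (@le_trans _ _ ((\sum_n `|mt n|) * (e / A * `|y - z|) +
    (\sum_l 2 * m l) * (e / A * `|y - z|))); last first.
  have -> : e * `|y - z| = A * (e / A * `|y - z|) by field; rewrite gt_eqF.
  rewrite -mulrDl ler_wpM2r ?(mulr_ge0 (ltW eA)) //.
  by rewrite /A -addrA lerDr.
apply: lerD.
  rewrite (le_trans (ler_norm_sum _ _ _)) // mulr_suml; apply: ler_sum => n _.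
  rewrite normrZ ler_wpM2l //.
  have -> : row j (y - z) = (row j y - b n) - (row j z - b n).
    by rewrite rowB opprB addrA subrK.
  have sh w : `|w - xi| < r -> `|row j w - b n - row j xi| < r1 j.
    move=> wr; rewrite (lt_le_trans _ (k1 j)) // (lt_le_trans _ rr1) //.
    rewrite addrAC (le_lt_trans (ler_normB _ _)) //.
    by rewrite ltrD // ry.
  rewrite (le_trans ((h1 j).2 _ _ (sh _ yr) (sh _ zr))) // ler_wpM2l ?(ltW eA) //.
  by rewrite opprB addrA subrK -rowB norm_row_le.
rewrite (le_trans (ler_norm_sum _ _ _)) // mulr_suml big_mkcond /=.
apply: ler_sum => l _; case: ifP => [lj|_]; last first.
  by rewrite mulr_ge0 ?(mulr_ge0 (ltW eA)) // mulr_ge0 // ltW.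
rewrite normrZ gtr0_norm // -mulrA mulrCA ler_wpM2l ?(ltW (hm _)) //.
have E : row j (y - z) - row l (y - z) = (row j y - row l y) - (row j z - row l z).
  by rewrite !rowB !opprB addrACA [RHS]addrACA; congr (_ + _); rewrite addrC.
have sh w : `|w - xi| < r -> `|row j w - row l w - (row j xi - row l xi)| < r2 (j, l).
  move=> wr; rewrite (lt_le_trans _ (k2 (j, l))) // (lt_le_trans _ rr2) //.
  have -> : row j w - row l w - (row j xi - row l xi) =
     (row j w - row j xi) - (row l w - row l xi).
    by rewrite !opprB addrACA [RHS]addrACA; congr (_ + _); rewrite addrC.
  by rewrite (le_lt_trans (ler_normB _ _)) // ltrD // ry.
rewrite E (le_trans ((h2 (j, l)).2 lj _ _ (sh _ yr) (sh _ zr))) //= mulrCA.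
rewrite ler_wpM2l ?(ltW eA) // -E (le_trans (ler_normB _ _)) //.
have := norm_row_le (y - z) j; have := norm_row_le (y - z) l; lra.
Qed.

Lemma force_center_Lipschitz xi : Sigma xi -> exists2 C, 0 < C &
  exists2 r, 0 < r & forall b t, 0 <= t -> t < r -> (forall n, `|b n| <= t) ->
    `|force b xi - force (fun=> 0) xi| <= C * t.
Proof.
move=> [x0 xx].
have /choice[Cr h1] : forall j, exists Cr : R * R, [/\ 0 < Cr.1, 0 < Cr.2 &
    forall q q' : rV, `|q - row j xi| < Cr.2 -> `|q' - row j xi| < Cr.2 ->
    `|kepler q - kepler q'| <= Cr.1 * `|q - q'|].
  move=> j; have [C C0 [r r0 h]] := strict_diff_Lipschitz (strict_diff_kepler (x0 j)).
  by exists (C, r).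
have C0 j : 0 < (Cr j).1 by have [] := h1 j.
have r0 j : 0 < (Cr j).2 by have [] := h1 j.
have [s s0 ks] := common_radius r0.
pose A := 1 + \sum_j \sum_n `|mt n| * (Cr j).1.
have pos j : 0 <= \sum_n `|mt n| * (Cr j).1.
  by rewrite sumr_ge0 // => n _; rewrite mulr_ge0 // ltW.
exists A; first by rewrite ltr_pwDl // sumr_ge0.
exists s => // b t t0 ts bt.
apply: norm_le_rows => [|j].
  by rewrite mulr_ge0 // addr_ge0 // sumr_ge0.
have -> : row j (force b xi - force (fun=> 0) xi) =
    - \sum_n mt n *: (kepler (row j xi - b n) - kepler (row j xi)).
  have -> : \sum_n mt n *: (kepler (row j xi - b n) - kepler (row j xi)) =
    \sum_n mt n *: kepler (row j xi - b n) - \sum_n mt n *: kepler (row j xi - 0).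
    by rewrite -sumrB; apply: eq_bigr => n _; rewrite subr0 scalerBr.
  rewrite (rowB j (force b xi)) !row_force.
  move: (bigop _ _ _) (bigop _ _ _) (bigop _ _ _) => S1 S2 S3.
  by apply/rowP => i; rewrite !mxE; ring.
rewrite normrN (le_trans (ler_norm_sum _ _ _)) //.
apply: (@le_trans _ _ ((\sum_n `|mt n| * (Cr j).1) * t)); last first.
  rewrite ler_wpM2r // ler_wpDl // (bigD1 j) //= lerDl.
  by rewrite sumr_ge0.
rewrite mulr_suml; apply: ler_sum => n _; rewrite normrZ -mulrA ler_wpM2l //.
have [_ _ /(_ (row j xi - b n) (row j xi)) h] := h1 j.
rewrite (le_trans (h _ _)) ?subrr ?normr0 //.
  by rewrite addrAC subrr sub0r normrN (le_lt_trans (bt n)) // (lt_le_trans ts (ks j)).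
by rewrite addrAC subrr sub0r normrN ler_pM2l.
Qed.

End ShiftedForces.

Section SphereHessian.
Context {R : realType} {H k : nat}.
Variables (m : 'I_H -> R) (mt : R).
Hypothesis hm : forall j, 0 < m j.
Local Notation V := 'M[R]_(H, k).
Implicit Types (y z u v xi : V).

Lemma strict_diff_gforce xi : Sigma xi -> strict_diff (gforce m mt) xi (dforce m mt xi).
Proof.
move=> xS; split; first by apply: linear_bounded => c u v; exact: dforce_linear.
move=> e e0; have [r r0 h] := force_strict (fun _ : 'I_1 => mt) hm xS e0.
exists r => // y z yr zr; have := h y z (fun=> 0) yr zr; rewrite !force0 big_ord1.
by apply => n; rewrite normr0.
Qed.

Lemma strict_diff_sphere_grad xi : Sigma xi ->
  strict_diff (fun y => gforce m mt y + potential mt m y *: y) xi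
    (fun v => dforce m mt xi v + (mdot m (gforce m mt xi) v *: xi
                                 + potential mt m xi *: v)).
Proof.
move=> xS; apply: strict_diff_mx => j i.
have dc x : strict_diff (fun y : V => y j i : R) x (fun v : V => v j i : R).
  apply: strict_diff_linear => [u v|]; first by rewrite !mxE.
  by exists 1 => v; rewrite mul1r coord_le_norm.
have LB (u v : V) : (u - v) j i = u j i - v j i by rewrite !mxE.
have dG := strict_diff_comp LB (strict_diff_gforce xS) (dc (gforce m mt xi)).
have dU := strict_diff_potential m mt xS.
have := strict_diffD dG (strict_diffM dU (dc xi)).
by congr strict_diff; apply/funext => v; rewrite !mxE.
Qed.

Lemma Sigma_near xi : Sigma xi -> \forall y \near xi, Sigma y.
Proof.
move=> /(Sigma_gap (N := 1))[r r0 h]; near=> y.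
have [] := h y (fun=> 0) _ (fun=> _).
- by rewrite distrC; near: y; apply: (@cvgr_dist_lt _ _ _ _ _ id xi) => //; exact: cvg_id.
- by rewrite normr0.
- by move=> h1 h2; split=> // j; exact: h1 ord0.
Unshelve. all: by end_near. Qed.

(** The component of the gradient tangent to the sphere vanishes, and Euler's
    identity gives the radial one. *)
Lemma central_gforce xi : central_configuration mt m xi ->
  gforce m mt xi = - potential mt m xi *: xi.
Proof.
move=> [x1 xS xc]; set U0 := potential mt m xi.
have xx : mdot m xi xi = 1 by rewrite -sqr_mnorm // x1 expr1n.
have gx : mdot m (gforce m mt xi) xi = - U0 := Euler_potential _ _ _.
pose v := gforce m mt xi + U0 *: xi.
have vx : mdot m v xi = 0 by rewrite mdotDl mdotZl gx xx mulr1 addNr.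
have gv : mdot m (gforce m mt xi) v = 0 by rewrite -derive_potential // xc.
have vv : mdot m v v = 0 by rewrite {1}/v mdotDl mdotZl gv mdotC vx mulr0 addr0.
have : v = 0 by apply: (mnorm_eq0 hm); rewrite /mnorm vv sqrtr0.
by move=> /eqP; rewrite addr_eq0 -scaleNr => /eqP.
Qed.

(** The tangential derivative of grad U - <grad U, y> y: the derivative of the
    scalar <grad U, y> contributes only a multiple of xi, which is projected out,
    while its value - U(xi) produces the zeroth-order term.  The differential of
    the gradient preserves the tangent space because it has xi as eigenvector. *)
Lemma sphere_hessE xi v : central_configuration mt m xi -> mdot m v xi = 0 ->
  sphere_hess m (potential mt m) xi v = dforce m mt xi v + potential mt m xi *: v.
Proof.
move=> xc; have gE := central_gforce xc; have [x1 xS _] := xc => vx.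
have xx : mdot m xi xi = 1 by rewrite -sqr_mnorm // x1 expr1n.
set U0 := potential mt m xi in gE *.
have E : 'D_v (sphere_grad m (potential mt m)) xi =
    dforce m mt xi v + (mdot m (gforce m mt xi) v *: xi + U0 *: v).
  have near_eq : \forall y \near xi, gforce m mt y + potential mt m y *: y =
      sphere_grad m (potential mt m) y.
    near=> y; have yS : Sigma y by near: y; exact: Sigma_near.
    by rewrite /sphere_grad mgrad_potential // /tangent_proj Euler_potential scaleNr opprK.
  rewrite -(near_eq_derive _ near_eq).
  have h := strict_diff_is_derive v _ (strict_diff_sphere_grad xS).
  case: h => [c u|_ ->//].
  by rewrite dforceZ mdotZr !scalerDr !scalerA (mulrC (potential mt m xi) c).
rewrite /sphere_hess E /tangent_proj gE mdotZl (mdotC m xi) vx mulr0 scale0r add0r.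
rewrite mdotDl mdotZl vx mulr0 addr0 dforce_sym dforce_self // gE.
by rewrite !mdotZl (mdotC m xi) vx !mulr0 scale0r subr0.
Unshelve. all: by end_near. Qed.

End SphereHessian.

(** * Coercivity of the linearized operator *)

Section Rayleigh.
Context {R : realType} {H k : nat}.
Variables (m : 'I_H -> R).
Hypothesis hm : forall j, 0 < m j.
Local Notation V := 'M[R]_(H, k).
Implicit Types (u v x y xi : V).

(** The form <S u, v> is semi-definite; Cauchy-Schwarz for the pair v, S v gives
    |S v|^4 <= <S v, v> <S (S v), S v> <= K^2 |v|^2 |S v|^2. *)
Lemma symmetric_operator_norm (S : V -> V) (K : R) :
  (forall c u v, S (c *: u + v) = c *: S u + S v) ->
  (forall u v, mdot m (S u) v = mdot m (S v) u) ->
  (forall v, 0 <= mdot m (S v) v) -> 0 <= K ->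
  (forall v, mdot m (S v) v <= K * mdot m v v) ->
  forall v, mnorm m (S v) <= K * mnorm m v.
Proof.
move=> Sl Ss S0 K0 SK v.
have a_lin c x y z : mdot m (S (c *: x + y)) z = c * mdot m (S x) z + mdot m (S y) z.
  by rewrite Sl mdotPl.
have := psd_Cauchy_Schwarz a_lin (fun x y => Ss x y) S0 v (S v).
have h1 := SK v; have h2 := SK (S v); have p1 := S0 v; have p2 := S0 (S v).
move=> h3; have h4 := le_trans h3 (ler_pM p1 p2 h1 h2).
apply: mnorm_le => //; first by rewrite mulr_ge0 // mnorm_ge0.
rewrite exprMn sqr_mnorm //; have := mdotxx_ge0 hm (S v); rewrite le_eqVlt.
case/predU1P => [<-|Sp]; first by rewrite mulr_ge0 ?sqr_ge0 // mdotxx_ge0.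
rewrite -(ler_pM2r Sp) -expr2 (le_trans h4) // le_eqVlt; apply/orP; left.
by apply/eqP; ring.
Qed.

(** A continuous form attains its minimum on the compact unit sphere of a
    hyperplane.  The sphere is read in coordinates through [vec_mx]. *)
Lemma quadratic_form_min (L : V -> V) (D : set V) :
  (forall c u v, L (c *: u + v) = c *: L u + L v) ->
  (exists xi, D = [set v | mdot m v xi = 0]) ->
  (exists v, D v /\ v != 0) ->
  exists v0 mu, [/\ D v0, mdot m v0 v0 = 1, mdot m (L v0) v0 = mu &
    forall v, D v -> mu * mdot m v v <= mdot m (L v) v].
Proof.
move=> Ll [xi DE] [v1 [Dv1 v1n]].
have LB u v : L (u - v) = L u - L v by rewrite addrC -scaleN1r Ll scaleN1r addrC.
have [C LC] := linear_bounded Ll.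
have vecB (r s : 'rV[R]_(H * k)) : vec_mx (r - s) = vec_mx r - vec_mx s :> V.
  exact: linearB.
have vecn (r : 'rV[R]_(H * k)) : `|vec_mx r : V| <= `|r|.
  by apply: norm_le_coord => // j i; rewrite mxE coord_le_norm.
have sd_coord j i r : strict_diff (fun r : 'rV[R]_(H * k) => (vec_mx r : V) j i : R) r
    (fun r => (vec_mx r : V) j i : R).
  apply: strict_diff_linear => [y z|]; first by rewrite vecB !mxE.
  by exists 1 => v; rewrite mul1r (le_trans (coord_le_norm _ _ _)).
have sd_L j i r : strict_diff (fun r : 'rV[R]_(H * k) => L (vec_mx r) j i : R) r
    (fun r => L (vec_mx r) j i : R).
  apply: strict_diff_linear => [y z|]; first by rewrite vecB LB !mxE.
  exists `|C| => v; rewrite (le_trans (coord_le_norm _ _ _)) // (le_trans (LC _)) //.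
  rewrite (@le_trans _ _ (`|C| * `|vec_mx v : V|)) ?ler_wpM2l //.
  by rewrite ler_wpM2r // ler_norm.
have cmdot (F G : 'rV[R]_(H * k) -> V) (F' G' : 'rV[R]_(H * k) -> V) r :
    (forall j i, strict_diff (fun r => F r j i : R) r (fun r => F' r j i : R)) ->
    (forall j i, strict_diff (fun r => G r j i : R) r (fun r => G' r j i : R)) ->
    {for r, continuous (fun r => mdot m (F r) (G r))}.
  move=> dF dG; have -> : (fun r => mdot m (F r) (G r)) =
    (fun r => \sum_j \sum_i m j * (F r j i * G r j i)).
    by apply/funext => s; rewrite mdotE.
  apply: strict_diff_continuous (strict_diff_sum (index_enum 'I_H) (P := xpredT)
    (fun j _ => strict_diff_sum (index_enum 'I_k) (P := xpredT)
     (fun i _ => strict_diff_scale (m j) (strict_diffM (dF j i) (dG j i))))).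
pose A := [set r : 'rV[R]_(H * k) | mdot m (vec_mx r) xi = 0] `&`
          [set r : 'rV[R]_(H * k) | mdot m (vec_mx r) (vec_mx r) = 1].
have cst_sd j i r : strict_diff (fun _ : 'rV[R]_(H * k) => xi j i : R) r (fun _ => 0 : R).
  exact: strict_diff_cst.
have clA : closed A.
  apply: closedI.
    apply: (closed_comp (f := fun r => mdot m (vec_mx r) xi) (D := [set 0])).
      move=> r _; apply: (cmdot vec_mx (fun=> xi) vec_mx (fun=> 0)) => j i.
        exact: sd_coord.
      have := cst_sd j i r; congr strict_diff.
      by apply/funext => s; rewrite mxE.
    exact: closed_eq.
  apply: (closed_comp (f := fun r => mdot m (vec_mx r) (vec_mx r)) (D := [set 1])).
    by move=> r _; apply: (cmdot vec_mx vec_mx vec_mx vec_mx) => j i; exact: sd_coord.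
  exact: closed_eq.
have [B B0 hB] := norm_le_mnorm (k := k) hm.
have bA : bounded_set A.
  exists B; split; first exact: num_real.
  move=> t Bt r [_ /= r1]; rewrite (le_trans _ (ltW Bt)) //.
  apply: norm_le_coord; first exact: ltW.
  move=> j i; rewrite ord1 -[r]vec_mxK; case/mxvec_indexP: i => a b.
  rewrite mxvecE (le_trans (coord_le_norm _ _ _)) // (le_trans (hB _)) //.
  by rewrite /mnorm r1 sqrtr1 mulr1.
have A0 : A !=set0.
  have n1 : mnorm m v1 != 0 by apply: contra v1n => /eqP/(mnorm_eq0 hm) ->.
  exists (mxvec ((mnorm m v1)^-1 *: v1)); split => /=; rewrite mxvecK.
    by move: Dv1; rewrite DE /= mdotZl => ->; rewrite mulr0.
  by rewrite mdotZl mdotZr -sqr_mnorm //; field.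
have cQ : {within A, continuous (fun r => mdot m (L (vec_mx r)) (vec_mx r))}.
  apply: continuous_subspaceT => r.
  apply: (cmdot (fun r => L (vec_mx r)) vec_mx (fun r => L (vec_mx r)) vec_mx) => j i.
    exact: sd_L.
  exact: sd_coord.
have [r /set_mem[r0 r1] rmin] := compact_EVT_min A0 (bounded_closed_compact bA clA) cQ.
exists (vec_mx r), (mdot m (L (vec_mx r)) (vec_mx r)); split=> //; first by rewrite DE.
move=> v Dv; have [->|vn] := eqVneq v 0.
  by rewrite mdot0l mulr0 mdotC mdot0l.
have n1 : mnorm m v != 0 by apply: contra vn => /eqP/(mnorm_eq0 hm) ->.
have n2 : 0 < mdot m v v by rewrite -sqr_mnorm // exprn_gt0 // lt_def n1 mnorm_ge0.
pose c := (mnorm m v)^-1.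
have /rmin : mxvec (c *: v) \in A.
  apply/mem_set; split => /=; rewrite mxvecK.
    by move: Dv; rewrite DE /= mdotZl => ->; rewrite mulr0.
  by rewrite mdotZl mdotZr -sqr_mnorm // /c; field.
have L0 : L 0 = 0.
  by apply: (@addrI _ (L 0)); rewrite -{1}[L 0]scale1r -Ll !addr0 scaler0.
rewrite mxvecK -[c *: v]addr0 Ll L0 !addr0 mdotZl mdotZr mulrA -expr2 /c exprVn.
by rewrite sqr_mnorm // mulrC ler_pdivlMr.
Qed.

End Rayleigh.

Section Coercivity.
Context {R : realType} {H k : nat}.
Variables (m : 'I_H -> R).
Hypothesis hm : forall j, 0 < m j.
Local Notation V := 'M[R]_(H, k).
Variables (xi : V) (U0 : R) (L : V -> V).
Hypothesis mdot_xi : mdot m xi xi = 1.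
Hypothesis Ll : forall c u v, L (c *: u + v) = c *: L u + L v.
Hypothesis Lsym : forall u v, mdot m (L u) v = mdot m (L v) u.
Hypothesis Lxi : L xi = (2 * U0) *: xi.
Implicit Types (u v : V).

Lemma mdot_L_xi v : mdot m (L v) xi = 2 * U0 * mdot m v xi.
Proof. by rewrite Lsym Lxi mdotZl mdotC. Qed.

(** The minimum mu of the Rayleigh quotient is an eigenvalue: the semi-definite
    form P u v = <L u - mu u, v> of the tangent space vanishes at the minimizer
    v0, so by Cauchy-Schwarz v0 is in its kernel; the test vector
    L v0 - mu v0 is tangent because L preserves the line of xi. *)
Lemma minimal_tangent_eigenvector : (exists v, mdot m v xi = 0 /\ v != 0) ->
  exists v0 mu, [/\ mdot m v0 xi = 0, v0 != 0, L v0 = mu *: v0 &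
    forall v, mdot m v xi = 0 -> mu * mdot m v v <= mdot m (L v) v].
Proof.
move=> nontriv; have [v0 [mu [v0x v0n Qv0 v0min]]] :=
  quadratic_form_min hm (D := [set v | mdot m v xi = 0]) Ll (ex_intro _ xi erefl) nontriv.
exists v0, mu; split=> //.
  by apply/eqP => v00; move: v0n; rewrite v00 mdot0l => /esym/eqP; rewrite oner_eq0.
(* Composing with the projection T extends the form to the whole space. *)
pose T v := v - mdot m v xi *: xi.
have Tt v' : mdot m (T v') xi = 0 by rewrite mdotBl mdotZl mdot_xi mulr1 subrr.
have Tid v' : mdot m v' xi = 0 -> T v' = v' by rewrite /T => ->; rewrite scale0r subr0.
have Tl c x y : T (c *: x + y) = c *: T x + T y.
  by rewrite /T mdotPl scalerDl scalerBr scalerA opprD addrACA.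
pose P x y := mdot m (L (T x)) (T y) - mu * mdot m (T x) (T y).
have Pl c x y z : P (c *: x + y) z = c * P x z + P y z.
  by rewrite /P Tl Ll !mdotPl; ring.
have Ps x y : P x y = P y x by rewrite /P Lsym (mdotC m (T x)).
have P0 x : 0 <= P x x by rewrite subr_ge0; exact: v0min (Tt x).
pose z := L v0 - mu *: v0.
have zt : mdot m z xi = 0 by rewrite mdotBl mdotZl mdot_L_xi v0x !mulr0 subr0.
have := psd_Cauchy_Schwarz Pl Ps P0 v0 z.
have -> : P v0 v0 = 0 by rewrite /P (Tid _ v0x) Qv0 v0n mulr1 subrr.
rewrite mul0r.
have -> : P v0 z = mdot m z z by rewrite /P (Tid _ v0x) (Tid _ zt) -mdotZl -mdotBl.
rewrite expr2 => z2; have z0 := mdotxx_ge0 hm z.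
have zz : mdot m z z = 0 by nra.
have /eqP : z = 0 by apply: (mnorm_eq0 hm); rewrite /mnorm zz sqrtr0.
by rewrite subr_eq0 => /eqP.
Qed.

(** The operator B of the equation w'' = B w, where 9 / 4 is the sum of the 2 of
    the linear term and of the 1 / 4 due to the factor e^(- s / 2). *)
Definition linearized_operator v : V := (9 / 4) *: v + (2 / U0) *: L v.

Lemma linearized_operator_linear c u v : linearized_operator (c *: u + v) =
  c *: linearized_operator u + linearized_operator v.
Proof.
rewrite /linearized_operator Ll; move: (L u) (L v) => Lu Lv.
by apply/matrixP => j i; rewrite !mxE; ring.
Qed.

(** B is 25 / 4 in the direction of xi and at least 1 / 4 + 2 nu1 / U0 on its
    orthogonal complement, which is positive by (BS); these two spaces are
    invariant, so B >= delta on the whole.  Any M^2 above the sum of delta and a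
    bound of B then makes M^2 - B a nonnegative operator below M^2 - delta. *)
Lemma linearized_operator_contraction nu1 : 0 < U0 -> - (1 / 8) * U0 < nu1 ->
  (forall v, mdot m v xi = 0 -> (nu1 - U0) * mdot m v v <= mdot m (L v) v) ->
  exists M delta, [/\ 0 < M, 0 < delta, delta <= M ^+ 2 & forall v,
    mnorm m (M ^+ 2 *: v - linearized_operator v) <= (M ^+ 2 - delta) * mnorm m v].
Proof.
move=> U00 BS coercive; pose B := linearized_operator.
have U0n : U0 != 0 by rewrite gt_eqF.
pose d := 1 / 4 + 2 * nu1 / U0.
have d0 : 0 < d.
  have -> : d = (2 / U0) * (nu1 - - (1 / 8) * U0) by rewrite /d; field.
  by rewrite mulr_gt0 ?divr_gt0 // subr_gt0.
pose delta := Num.min (25 / 4) d.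
have delta0 : 0 < delta by rewrite lt_min d0 divr_gt0.
have BE v : mdot m (B v) v = 9 / 4 * mdot m v v + 2 / U0 * mdot m (L v) v.
  by rewrite mdotDl !mdotZl.
have Blow v : delta * mdot m v v <= mdot m (B v) v.
  pose a := mdot m v xi; pose t := v - a *: xi.
  have tx : mdot m t xi = 0 by rewrite mdotBl mdotZl mdot_xi mulr1 subrr.
  have vE : v = a *: xi + t by rewrite addrC subrK.
  have vv : mdot m v v = a ^+ 2 + mdot m t t.
    rewrite {1}vE mdotDl mdotZl {1}vE mdotDr mdotZr mdot_xi mdotC tx.
    by rewrite {1}vE mdotDr mdotZr tx; ring.
  have Lv : mdot m (L v) v = 2 * U0 * a ^+ 2 + mdot m (L t) t.
    rewrite {1}vE Ll mdotDl mdotZl Lxi mdotZl (mdotC m xi).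
    by rewrite -/a {1}vE mdotDr mdotZr mdot_L_xi tx; ring.
  have := coercive _ tx; rewrite BE vv Lv => h.
  have p := mdotxx_ge0 hm t; have pa := sqr_ge0 a.
  have h1 : delta * a ^+ 2 <= 25 / 4 * a ^+ 2 by rewrite ler_wpM2r // ge_min lexx.
  have h2 : delta * mdot m t t <= d * mdot m t t.
    by rewrite ler_wpM2r // ge_min lexx orbT.
  have h3 : 2 / U0 * ((nu1 - U0) * mdot m t t) <= 2 / U0 * mdot m (L t) t.
    by rewrite ler_wpM2l // divr_ge0 // ltW.
  have h4 : d * mdot m t t = 9 / 4 * mdot m t t + 2 / U0 * ((nu1 - U0) * mdot m t t).
    by rewrite /d; field.
  have h5 : 2 / U0 * (2 * U0 * a ^+ 2 + mdot m (L t) t) =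
      4 * a ^+ 2 + 2 / U0 * mdot m (L t) t by field.
  by rewrite h5; lra.
have [C LC] := linear_bounded Ll.
have [C1 C10 hC1] := mnorm_le_norm (k := k) hm.
have [C2 C20 hC2] := norm_le_mnorm (k := k) hm.
pose K := C1 * (`|C| * C2).
have K0 : 0 <= K by rewrite !mulr_ge0 // ltW.
have LK v : mdot m (L v) v <= K * mdot m v v.
  rewrite (le_trans (mdot_le hm _ _)) // -sqr_mnorm // expr2 mulrA.
  rewrite ler_wpM2r ?mnorm_ge0 // (le_trans (hC1 _)) // /K -!mulrA ler_wpM2l ?(ltW C10) //.
  rewrite (le_trans (LC _)) // (@le_trans _ _ (`|C| * `|v|)) ?ler_wpM2l //.
  by rewrite ler_wpM2r // ler_norm.
pose M2 := 9 / 4 + 2 / U0 * K + delta.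
have M20 : delta <= M2.
  by rewrite lerDr addr_ge0 ?divr_ge0 // mulr_ge0 // divr_ge0 // ltW.
have M20' : 0 < M2 := lt_le_trans delta0 M20.
exists (Num.sqrt M2), delta; rewrite sqr_sqrtr ?(ltW M20') //; split=> //.
  by rewrite sqrtr_gt0.
pose S v := M2 *: v - B v.
have SE v : mdot m (S v) v = M2 * mdot m v v - mdot m (B v) v by rewrite mdotBl mdotZl.
have Sl c u v : S (c *: u + v) = c *: S u + S v.
  rewrite /S /B linearized_operator_linear; move: (linearized_operator u) (linearized_operator v).
  by move=> Bu Bv; apply/matrixP => j i; rewrite !mxE; ring.
apply: (symmetric_operator_norm hm (S := S)) => //.
- move=> u v; rewrite /S /B !(mdotBl, mdotDl, mdotZl).
  by rewrite (mdotC m u v) Lsym.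
- move=> v; rewrite SE BE.
  have h1 : 2 / U0 * mdot m (L v) v <= 2 / U0 * (K * mdot m v v).
    by rewrite ler_wpM2l // divr_ge0 // ltW.
  have h2 : M2 * mdot m v v = 9 / 4 * mdot m v v + 2 / U0 * (K * mdot m v v)
     + delta * mdot m v v by rewrite /M2; ring.
  have h3 : 0 <= delta * mdot m v v by rewrite mulr_ge0 ?(ltW delta0) // mdotxx_ge0.
  by rewrite h2; lra.
- by rewrite subr_ge0.
- by move=> v; rewrite SE mulrBl; have := Blow v; lra.
Qed.

End Coercivity.

Section CentralConfiguration.
Context {R : realType} {H k : nat}.
Variables (m : 'I_H -> R) (mt : R).
Hypothesis hm : forall j, 0 < m j.
Variables (xi : 'M[R]_(H, k)) (nu1 : R).
Hypothesis hxi : central_configuration mt m xi.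
Hypothesis hnu1 : smallest_hess_eigenvalue m (potential mt m) xi nu1.

Lemma mdot_central : mdot m xi xi = 1.
Proof. by have [x1 _ _] := hxi; rewrite -sqr_mnorm // x1 expr1n. Qed.

Lemma dforce_central : dforce m mt xi xi = (2 * potential mt m xi) *: xi.
Proof.
have [_ xS _] := hxi; rewrite dforce_self // central_gforce // scalerA.
by congr (_ *: _); ring.
Qed.

(** On tangent vectors DG is the Hessian on the sphere minus U(xi), and its
    minimal tangent eigenvector is one of the Hessian. *)
Lemma dforce_coercive v : mdot m v xi = 0 ->
  (nu1 - potential mt m xi) * mdot m v v <= mdot m (dforce m mt xi v) v.
Proof.
have [[w [w0 wt _]] nu1_min] := hnu1.
have [v0 [mu [v0x v0n Lv0 v0min]]] := minimal_tangent_eigenvector hm mdot_central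
  (dforce_linear m mt xi) (dforce_sym m mt xi) dforce_central
  (ex_intro _ w (conj wt w0)).
have h : nu1 <= mu + potential mt m xi.
  apply: nu1_min; exists v0; split=> //.
  by rewrite (sphere_hessE hm hxi v0x) Lv0 (scalerDl v0 mu).
move=> vt; apply: le_trans (v0min v vt); rewrite ler_wpM2r ?mdotxx_ge0 //; lra.
Qed.

Lemma linearized_contraction : 0 < potential mt m xi ->
  - (1 / 8) * potential mt m xi < nu1 ->
  exists M delta, [/\ 0 < M, 0 < delta, delta <= M ^+ 2 & forall v,
    mnorm m (M ^+ 2 *: v - ((9 / 4) *: v +
      (2 / potential mt m xi) *: dforce m mt xi v)) <= (M ^+ 2 - delta) * mnorm m v].
Proof.
move=> U0 BS; exact: (linearized_operator_contraction hm mdot_central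
  (dforce_linear m mt xi) (dforce_sym m mt xi) dforce_central U0 BS dforce_coercive).
Qed.

End CentralConfiguration.

(** * Continuity of the force along a curve *)

Section Continuity.
Context {R : realType} {H k N : nat}.
Variables (m : 'I_H -> R) (mt : 'I_N -> R).
Local Notation V := 'M[R]_(H, k).
Local Notation rV := 'rV[R]_k.

Lemma continuous_at_sum (W : normedModType R) (I : Type) (r : seq I) (P : pred I)
    (f : I -> R -> W) (s : R) : (forall i, P i -> {for s, continuous (f i)}) ->
  {for s, continuous (fun t => \sum_(i <- r | P i) f i t)}.
Proof.
move=> cf; suff : \sum_(i <- r | P i) f i t @[t --> s] --> \sum_(i <- r | P i) f i s by [].
elim: r => [|i r IH].
  by under eq_fun do rewrite big_nil; rewrite big_nil; exact: cvg_cst.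
under eq_fun do rewrite big_cons; rewrite big_cons.
by case: ifP => // Pi; apply: cvgD => //; exact: cf.
Qed.

Lemma continuous_at_mx (p q : nat) (w : R -> 'M[R]_(p, q)) (s : R) :
  (forall j i, {for s, continuous (fun t => w t j i)}) <-> {for s, continuous w}.
Proof.
split=> [cw|cw j i]; last first.
  suff h : {for s, continuous ((fun M : 'M[R]_(p, q) => M j i) \o w)} by exact: h.
  by apply: continuous_comp; [exact: cw|exact: coord_continuous].
apply/cvgrPdist_le => e e0.
have : \forall t \near s, forall ji : 'I_p * 'I_q, `|w s ji.1 ji.2 - w t ji.1 ji.2| <= e.
  have h (ji : ('I_p * 'I_q)%type) : \forall t \near s, `|w s ji.1 ji.2 - w t ji.1 ji.2| <= e.
    by have /cvgrPdist_le := cw ji.1 ji.2; exact.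
  exact: filter_forall h.
apply: filterS => t wt; apply: norm_le_coord => [|j i]; first exact: ltW.
by rewrite !mxE; exact: (wt (j, i)).
Qed.

Lemma continuous_at_force (b : R -> 'I_N -> rV) (y : R -> V) (s : R) :
  {for s, continuous y} -> (forall n, {for s, continuous (fun t => b t n)}) ->
  (forall j n, row j (y s) != b s n) ->
  (forall l j, l != j -> row l (y s) != row j (y s)) ->
  {for s, continuous (fun t => force m mt (b t) (y t))}.
Proof.
move=> cy cb yb yy.
have crow j : {for s, continuous (fun t => row j (y t))}.
  suff h : {for s, continuous (row j \o y)} by exact: h.
  apply: continuous_comp; first exact: cy.
  exact: strict_diff_continuous (strict_diff_row j (y s)).
have ck (q : R -> rV) : {for s, continuous q} -> q s != 0 ->
    {for s, continuous (fun t => kepler (q t))}.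
  move=> cq q0; suff h : {for s, continuous (kepler \o q)} by exact: h.
  apply: continuous_comp; first exact: cq.
  exact: strict_diff_continuous (strict_diff_kepler q0).
apply/continuous_at_mx => j i.
have h : {for s, continuous (fun t => row j (force m mt (b t) (y t)))}.
  suff : row j (force m mt (b t) (y t)) @[t --> s] --> row j (force m mt (b s) (y s)).
    by [].
  under eq_fun do rewrite row_force; rewrite row_force.
  apply: cvgB; [apply: cvgN|]; apply: continuous_at_sum.
    move=> n _; apply: cvgZl_tmp; apply: ck; last by rewrite subr_eq0.
    by apply: cvgB; [exact: crow|exact: cb].
  move=> l lj; apply: cvgZl_tmp; apply: ck; last by rewrite subr_eq0 yy // eq_sym.
  by apply: cvgB; exact: crow.
have /continuous_at_mx /(_ 0 i) hi := h.
suff : force m mt (b t) (y t) j i @[t --> s] --> force m mt (b s) (y s) j i by [].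
have E t : force m mt (b t) (y t) j i = row j (force m mt (b t) (y t)) 0 i by rewrite mxE.
by under eq_fun do rewrite E; rewrite E; exact: hi.
Qed.

End Continuity.

(** * The equation in logarithmic time *)

Section LogarithmicTime.
Context {R : realType} {H k N : nat}.
Variables (m : 'I_H -> R) (mt : 'I_N -> R).
Hypothesis hm : forall j, 0 < m j.
Local Notation V := 'M[R]_(H, k).
Local Notation rV := 'rV[R]_k.
Variables (xi : V) (nu1 : R).
Local Notation mtot := (\sum_n mt n).
Local Notation U0 := (potential mtot m xi).
Hypothesis hxi : central_configuration mtot m xi.
Hypothesis hnu1 : smallest_hess_eigenvalue m (potential mtot m) xi nu1.
Hypothesis U0_gt0 : 0 < U0.
Hypothesis hBS : - (1 / 8) * U0 < nu1.

Implicit Types (s t : R) (w : V).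

Definition nonsingular (b : 'I_N -> rV) (y : V) :=
  (forall j n, row j y != b n) /\ (forall l j, l != j -> row l y != row j y).

(** The substitution h = e^(- s / 2) w turns the equation for h into
    w'' = w / 4 + e^(s / 2) (2 (xi + h) + (2 / U0) G(xi + h, b)), to which
    [half_line_bvp] applies with kap = M^2 - delta / 2: half of the gap delta
    absorbs the Lipschitz constant of the remainder, the other half its value at
    w = 0.  The factor e^(s / 2) is harmless, since it cancels against the
    e^(- s / 2) of h in the former and against the decay of b in the latter. *)
Lemma logarithmic_time_solution : exists eps beta0 : R, [/\ 0 < eps, eps <= 1 / 2, 0 < beta0 &
  forall (b : R -> 'I_N -> rV) (beta : R),
    (forall n, continuous (fun s => b s n)) -> 0 <= beta -> beta <= beta0 ->
    (forall s n, 0 <= s -> `|b s n| <= beta * expR (- 2 * s)) ->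
  forall h0 : V, mnorm m h0 <= eps ->
  exists (h h1 h2 : R -> V) (C : R), [/\ h 0 = h0,
    forall s, 0 <= s -> derive_coord h h1 s,
    forall s, 0 <= s -> derive_coord h1 h2 s &
    forall s, 0 <= s -> [/\ h2 s + h1 s =
        2 *: (xi + h s) + (2 / U0) *: force m mt (b s) (xi + h s),
      mnorm m (h s) <= eps * expR (- (1 / 2) * s),
      forall j i, `|h1 s j i| <= C * expR (- (1 / 2) * s) &
      nonsingular (b s) (xi + h s)]]].
Proof.
have [_ xS _] := hxi.
have [M [delta [M0 delta0 deltaM contr]]] := linearized_contraction hm hxi hnu1 U0_gt0 hBS.
set u := U0 in contr *; have u0 : 0 < u := U0_gt0.
have un : u != 0 by rewrite gt_eqF.
have fxi : (2 / u) *: force m mt (fun=> 0) xi = - (2 *: xi).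
  rewrite force0 (central_gforce hm hxi) scalerA -scaleNr.
  by congr (_ *: _); rewrite -/u; field.
clearbody u.
have [C1 C10 hC1] := mnorm_le_norm (k := k) hm.
have [C2 C20 hC2] := norm_le_mnorm (k := k) hm.
have C1n : C1 != 0 by rewrite gt_eqF.
have C2n : C2 != 0 by rewrite gt_eqF.
(* With this e the remainder has Lipschitz constant (2 / u) C1 e C2 = delta / 2;
   C1 and C2 compare the norm of the space with the mass norm. *)
pose e := delta * u / (4 * C1 * C2).
have e0 : 0 < e by rewrite divr_gt0 ?mulr_gt0.
have [rs rs0 strict] := force_strict mt hm xS e0.
have [rg rg0 gap] := Sigma_gap (N := N) xS.
have [CL CL0 [rL rL0 lip]] := force_center_Lipschitz m mt xS.
pose r := Num.min rs (Num.min rg rL).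
have r0 : 0 < r by rewrite !lt_min rs0 rg0.
have r_rs : r <= rs by rewrite ge_min lexx.
have r_rg : r <= rg by rewrite !ge_min lexx orbT.
have r_rL : r <= rL by rewrite !ge_min lexx !orbT.
(* The bound 1 / 2 keeps xi + h away from 0 in the asymptotic estimates. *)
pose eps := Num.min (1 / 2) (r / (2 * C2)).
have eps0 : 0 < eps by rewrite lt_min !divr_gt0 ?mulr_gt0.
have C2eps : C2 * eps < r.
  have : C2 * eps <= C2 * (r / (2 * C2)) by rewrite ler_pM2l // ge_min lexx orbT.
  have -> : C2 * (r / (2 * C2)) = r / 2 by field.
  by move: r0; lra.
pose beta0 := Num.min (r / 2) (delta / 2 * eps / (2 / u * C1 * CL)).
have q0 : 0 < 2 / u * C1 * CL by rewrite mulr_gt0 // mulr_gt0 // divr_gt0.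
have beta00 : 0 < beta0 by rewrite lt_min divr_gt0 //= divr_gt0 // mulr_gt0 // divr_gt0.
exists eps, beta0; split=> //; first by rewrite ge_min lexx.
move=> b beta cb beta_ge0 beta_le b_le h0 h0eps.
pose a (s : R) := expR (- (1 / 2) * s).
have a0 s : 0 < a s := expR_gt0 _.
have an s : a s != 0 by rewrite gt_eqF.
have a1 s : 0 <= s -> a s <= 1.
  by move=> s0; rewrite /a expR_le1 mulNr oppr_le0 mulr_ge0 // divr_ge0.
pose y (s : R) (w : V) := xi + a s *: w.
pose F (s : R) (w : V) : V := M ^+ 2 *: w - (1 / 4) *: w -
  (a s)^-1 *: (2 *: y s w + (2 / u) *: force m mt (b s) (y s w)).
have b_small s n : 0 <= s -> `|b s n| < r.
  move=> s0; apply: le_lt_trans (b_le s n s0) _.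
  have hexp : expR (- 2 * s) <= 1 by rewrite expR_le1 mulNr oppr_le0 mulr_ge0.
  have h2 : beta * expR (- 2 * s) <= beta by rewrite ler_piMr.
  have h3 : beta <= r / 2 by rewrite (le_trans beta_le) // ge_min lexx.
  by move: h2 h3 r0; lra.
have y_near s w : 0 <= s -> mnorm m w <= eps -> `|y s w - xi| < r.
  move=> s0 w_eps; rewrite addrAC subrr add0r normrZ gtr0_norm //.
  apply: le_lt_trans C2eps; rewrite (@le_trans _ _ `|w|) ?ler_piMl ?a1 //.
  by rewrite (le_trans (hC2 _)) // ler_pM2l.
have gap_y s w : 0 <= s -> mnorm m w <= eps -> nonsingular (b s) (y s w).
  move=> s0 w_eps; apply: gap; first exact: lt_le_trans (y_near _ _ s0 w_eps) r_rg.
  by move=> n; exact: lt_le_trans (b_small _ _ s0) r_rg.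
have y_sub s w w' : y s w - y s w' = a s *: (w - w').
  by rewrite /y opprD addrACA subrr add0r scalerBr.
have ca : continuous a by move=> s; exact: is_derive_continuous (is_derive_expRM _ _).
have cF (w : R -> V) : continuous_coord w -> (forall s, mnorm m (w s) <= eps) ->
    continuous_coord (fun s => F (Num.max 0 s) (w s)).
  move=> cw w_eps j i s.
  have cmax : {for s, continuous (Num.max (0 : R))}.
    by apply: continuous_max; [exact: cst_continuous|exact: id].
  have s0 : 0 <= Num.max 0 s by rewrite le_max lexx.
  have cas : {for s, continuous (fun t => a (Num.max 0 t))}.
    suff h : {for s, continuous (a \o Num.max 0)} by exact: h.
    by apply: continuous_comp; [exact: cmax|exact: ca].
  have cbs n : {for s, continuous (fun t => b (Num.max 0 t) n)}.
    suff h : {for s, continuous ((fun t => b t n) \o Num.max 0)} by exact: h.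
    by apply: continuous_comp; [exact: cmax|exact: cb].
  have cws : {for s, continuous w} by apply/continuous_at_mx => l c; exact: cw.
  have cys : {for s, continuous (fun t => y (Num.max 0 t) (w t))}.
    by apply: cvgD; [exact: cvg_cst|apply: cvgZ; [exact: cas|exact: cws]].
  have [g1 g2] := gap_y _ _ s0 (w_eps s).
  have cfs := continuous_at_force (m := m) (mt := mt) cys cbs g1 g2.
  suff /continuous_at_mx h : {for s, continuous (fun s => F (Num.max 0 s) (w s))}.
    exact: h.
  apply: cvgB.
    by apply: cvgB; apply: cvgZl_tmp; exact: cws.
  apply: cvgZ; first by apply: cvgV; [exact: an|exact: cas].
  by apply: cvgD; apply: cvgZl_tmp; [exact: cys|exact: cfs].
have lF s : 0 <= s -> forall x y, mnorm m x <= eps -> mnorm m y <= eps ->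
    mnorm m (F s x - F s y) <= (M ^+ 2 - delta / 2) * mnorm m (x - y).
  move=> s0 x z xe ze.
  set f := force m mt (b s); set L := dforce m mtot xi.
  have -> : F s x - F s z =
      (M ^+ 2 *: (x - z) - ((9 / 4) *: (x - z) + (2 / u) *: L (x - z))) -
      ((a s)^-1 * (2 / u)) *: (f (y s x) - f (y s z) - L (y s x - y s z)).
    rewrite y_sub /L dforceZ -/L /F -/f /y.
    move: (f _) (f _) (L _) => fx fz Lxz.
    apply/matrixP => j i; rewrite !mxE; field.
    by rewrite an un.
  rewrite (le_trans (mnormD hm _ _)) // mnormN.
  have h1 := contr (x - z).
  have as0 : 0 <= (a s)^-1 * (2 / u) by rewrite mulr_ge0 ?invr_ge0 ?divr_ge0 // ltW.
  have h2 : mnorm m (((a s)^-1 * (2 / u)) *: (f (y s x) - f (y s z) - L (y s x - y s z)))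
      <= delta / 2 * mnorm m (x - z).
    rewrite mnormZ ger0_norm //.
    have st : `|f (y s x) - f (y s z) - L (y s x - y s z)| <= e * `|y s x - y s z|.
      apply: strict => [||n].
      - exact: lt_le_trans (y_near _ _ s0 xe) r_rs.
      - exact: lt_le_trans (y_near _ _ s0 ze) r_rs.
      - exact: lt_le_trans (b_small _ _ s0) r_rs.
    have -> : delta / 2 * mnorm m (x - z) = ((a s)^-1 * (2 / u)) *
        (C1 * (e * (a s * (C2 * mnorm m (x - z))))).
      by rewrite /e; field; rewrite an un C1n C2n.
    rewrite ler_wpM2l // (le_trans (hC1 _)) // ler_pM2l // (le_trans st) // ler_pM2l //.
    by rewrite y_sub normrZ gtr0_norm // ler_pM2l.
  by rewrite mulrBl; rewrite mulrBl in h1; move: h1 h2; lra.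
have F0 s : 0 <= s -> mnorm m (F s 0) <= (M ^+ 2 - (M ^+ 2 - delta / 2)) * eps.
  move=> s0.
  have -> : F s 0 = - (((a s)^-1 * (2 / u)) *:
      (force m mt (b s) xi - force m mt (fun=> 0) xi)).
    rewrite /F /y !scaler0 addr0 !subrr sub0r; congr (- _).
    by rewrite -(scalerA (a s)^-1 (2 / u)); congr (_ *: _); rewrite scalerBr fxi opprK addrC.
  rewrite mnormN mnormZ ger0_norm ?mulr_ge0 ?invr_ge0 ?divr_ge0 ?(ltW (a0 _)) ?(ltW u0) //.
  set t := beta * expR (- 2 * s).
  have t0 : 0 <= t by rewrite mulr_ge0 // expR_ge0.
  have ta : (a s)^-1 * t <= beta.
    rewrite /t /a -expRN mulrCA -expRD ler_piMr // expR_le1.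
    by move: s0; lra.
  have tL : t < rL.
    have h3 : beta <= r / 2 by rewrite (le_trans beta_le) // ge_min lexx.
    have h4 : t <= beta.
      by rewrite ler_piMr // expR_le1 mulNr oppr_le0 mulr_ge0.
    by move: h3 h4 r0 r_rL; lra.
  have hl := lip (b s) t t0 tL (fun n => b_le s n s0).
  have -> : (M ^+ 2 - (M ^+ 2 - delta / 2)) * eps =
      2 / u * C1 * CL * (delta / 2 * eps / (2 / u * C1 * CL)).
    by field; rewrite un C1n gt_eqF.
  rewrite (@le_trans _ _ (2 / u * C1 * CL * ((a s)^-1 * t))) //.
    have -> : 2 / u * C1 * CL * ((a s)^-1 * t) = (a s)^-1 * (2 / u) * (C1 * (CL * t)).
      by ring.
    rewrite ler_wpM2l ?mulr_ge0 ?invr_ge0 ?divr_ge0 ?(ltW (a0 _)) ?(ltW u0) //.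
    by rewrite (le_trans (hC1 _)) // ler_pM2l.
  by rewrite ler_pM2l // (le_trans ta) // (le_trans beta_le) // ge_min lexx orbT.
have kap0 : 0 <= M ^+ 2 - delta / 2 by move: delta0 deltaM; lra.
have kapM : M ^+ 2 - delta / 2 < M ^+ 2 by move: delta0; lra.
have [w [w1 [C [w_0 dw dw1 wP]]]] :=
  half_line_bvp hm M0 eps0 kap0 kapM cF lF F0 h0eps.
exists (fun s => a s *: w s), (fun s => a s *: (w1 s - (1 / 2) *: w s)).
exists (fun s => a s *: (M ^+ 2 *: w s - F s (w s) - w1 s + (1 / 4) *: w s)).
exists (C + C2 * eps); split.
- by rewrite /a mulr0 expR0 scale1r.
- move=> s s0 j i.
  rewrite (_ : (fun t => _) = (fun t => a t * w t j i)); last first.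
    by apply/funext => t; rewrite mxE.
  apply: is_derive_eq (is_derive_mulfun (is_derive_expRM _ s) (dw s s0 j i)) _.
  by rewrite !mxE -/(a s); field.
- move=> s s0 j i.
  rewrite (_ : (fun t => _) = (fun t => a t * (w1 t j i + (- (1 / 2)) * w t j i))); last first.
    by apply/funext => t; rewrite !mxE; ring.
  apply: is_derive_eq (is_derive_mulfun (is_derive_expRM _ s)
    (is_derive_addfun (dw1 s s0 j i) (is_derive_scalefun _ (dw s s0 j i)))) _.
  by rewrite -/(a s); move: (F s (w s)) => f; rewrite !mxE; field.
- move=> s s0; have [w_eps w1C] := wP s s0; split.
  + rewrite /F -/(y s (w s)); move: (force _ _ _ _) => f; rewrite /y.
    by apply/matrixP => j i; rewrite !mxE; field; rewrite an un.
  + by rewrite mnormZ gtr0_norm // mulrC ler_pM2r.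
  + move=> j i; rewrite !mxE normrM gtr0_norm // mulrC ler_pM2r //.
    rewrite (le_trans (ler_normB _ _)) // lerD //.
    rewrite normrM ger0_norm ?divr_ge0 // (@le_trans _ _ `|w s j i|) //.
      by rewrite ler_piMl // ler_pdivrMr // mul1r ler1n.
    rewrite (le_trans (coord_le_norm _ _ _)) // (le_trans (hC2 _)) //.
    by rewrite ler_pM2l.
  + exact: gap_y.
Qed.

End LogarithmicTime.

(** * Logarithmic time *)

Section HalfLineCalculus.
Context {R : realType} {H k : nat}.
Local Notation V := 'M[R]_(H, k).

Lemma halfline_derivative_coord (x dx : R -> V) :
  (forall t, 0 <= t -> derive_coord x dx t) -> halfline_derivative x dx.
Proof.
move=> dX t t0; apply/cvgrPdist_le => e e0.
have /choice[r hr] : forall ji : 'I_H * 'I_k, exists r, 0 < r /\ forall s,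
    `|s - t| < r -> s != t ->
    `|dx t ji.1 ji.2 - (s - t)^-1 * (x s ji.1 ji.2 - x t ji.1 ji.2)| <= e.
  move=> [j i] /=; have dxt := dX t t0 j i.
  have : h^-1 *: (((fun t => x t j i) \o shift t) (h *: 1) - x t j i) @[h --> 0^']
      --> dx t j i.
    by rewrite -(@derive_val _ _ _ _ _ _ _ dxt); exact: (@ex_derive _ _ _ _ _ _ _ dxt).
  move=> /cvgrPdist_le /(_ e e0)[r /= r0 hr]; exists r; split=> // s sr st.
  have := hr (s - t); rewrite /ball /= sub0r normrN subr_eq0 => /(_ sr st).
  by rewrite /GRing.scale /= mulr1 subrK.
have [r0 r00 r0r] := common_radius (fun ji => (hr ji).1).
rewrite near_withinE /= /dnbhs near_withinE.
have near_t : \forall s \near t, `|s - t| < r0.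
  near=> s; rewrite distrC; near: s.
  by apply: (@cvgr_dist_lt _ _ _ _ _ id t) => //; exact: cvg_id.
apply: filterS near_t => s sr st _.
apply: norm_le_coord => [|j i]; first exact: ltW.
rewrite !mxE; apply: (hr (j, i)).2 => //.
exact: lt_le_trans (r0r (j, i)).
Unshelve. all: by end_near. Qed.

End HalfLineCalculus.

Section Clock.
Context {R : realType}.
Variable t0 : R.
Hypothesis t0_gt0 : 0 < t0.
Implicit Types t s : R.

(** Along the homothetic motion |x| is proportional to (t + t0)^(2/3), that is
    to e^(2 s) for s = [clock t]. *)
Definition clock t : R := 3^-1 * ln ((t + t0) * t0^-1).

Lemma clock_arg_gt0 t : - t0 < t -> 0 < (t + t0) * t0^-1.
Proof. by move=> tt; rewrite mulr_gt0 ?invr_gt0 // -ltrBlDr sub0r. Qed.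

Lemma expR_clock t : - t0 < t -> expR (3 * clock t) = (t + t0) * t0^-1.
Proof.
move=> tt; rewrite /clock mulrA mulfV // mul1r lnK // posrE; exact: clock_arg_gt0.
Qed.

Lemma clock0 : clock 0 = 0.
Proof. by rewrite /clock add0r mulfV ?gt_eqF // ln1 mulr0. Qed.

Lemma clock_ge0 t : 0 <= t -> 0 <= clock t.
Proof.
move=> tt; rewrite mulr_ge0 ?invr_ge0 // ln_ge0 // ler_pdivlMr // mul1r.
by rewrite lerDr.
Qed.

Lemma is_derive_clock t : - t0 < t ->
  is_derive t 1 clock (expR (- 3 * clock t) / (3 * t0)).
Proof.
move=> tt; have p := clock_arg_gt0 tt.
have d1 : is_derive t 1 (fun t => t0^-1 * (t + t0)) (t0^-1 * (1 + 0)).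
  exact: (is_derive_scalefun t0^-1 (is_derive_addfun (is_derive_id t 1)
    (is_derive_cst t0 t 1))).
have p' : 0 < t0^-1 * (t + t0) by rewrite mulrC.
have := is_derive_scalefun 3^-1 (@is_derive1_comp R (@ln R) (fun t => t0^-1 * (t + t0)) t _ _
  (is_derive1_ln p') d1).
rewrite (_ : (fun t => _) = clock); last first.
  by apply/funext => s; rewrite /clock /= mulrC [_ * t0^-1]mulrC mulrC.
move=> d; apply: is_derive_eq d _.
rewrite mulNr expRN expR_clock //; field.
by rewrite !gt_eqF //; move: p; rewrite pmulr_lgt0 ?invr_gt0.
Qed.

Lemma clock_cvgy : clock t @[t --> +oo] --> +oo.
Proof.
apply/cvgryPge => A; near=> t.
have tA : t0 * expR (3 * A) <= t by near: t; apply: nbhs_pinfty_ge; exact: num_real.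
have tpos : 0 <= t by rewrite (le_trans _ tA) // mulr_ge0 ?expR_ge0 // ltW.
have tt : - t0 < t by rewrite (lt_le_trans _ tpos) // oppr_lt0.
have : expR (3 * A) <= expR (3 * clock t).
  rewrite expR_clock // ler_pdivlMr // mulrC (le_trans tA) // lerDl ltW //.
by rewrite ler_expR ler_pM2l.
Unshelve. all: by end_near. Qed.

Lemma clock_decay c : 0 < c -> expR (- c * clock t) @[t --> +oo] --> (0 : R).
Proof.
move=> c0; apply/cvgrPdist_le => e e0.
have /cvgryPge /(_ ((e^-1) / c)) := clock_cvgy; apply: filterS => t ht.
rewrite sub0r normrN ger0_norm ?expR_ge0 // mulNr expRN -[e]invrK.
rewrite lef_pV2 ?posrE ?expR_gt0 ?invr_gt0 //.
apply: le_trans (expR_ge1Dx _); rewrite ler_wpDl // -ler_pdivrMl //.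
by rewrite mulrC.
Qed.

End Clock.

(** * The motion and its asymptotics *)

Section Scaling.
Context {R : realType} {H k N : nat}.
Variables (m : 'I_H -> R) (mt : 'I_N -> R).
Local Notation V := 'M[R]_(H, k).
Local Notation rV := 'rV[R]_k.

Lemma forceZ (c : R) (b : 'I_N -> rV) (y : V) : 0 < c ->
  force m mt (fun n => c *: b n) (c *: y) = (c ^+ 2)^-1 *: force m mt b y.
Proof.
move=> c0; apply/row_matrixP => j.
rewrite (rowZ j _ (force m mt b y)) !row_force rowZ scalerBr scalerN.
rewrite !scaler_sumr; congr (- _ - _); apply: eq_bigr => i _.
  by rewrite -scalerBr keplerZ // !scalerA mulrC.
by rewrite rowZ -scalerBr keplerZ // !scalerA mulrC.
Qed.

Lemma cvg_dominated (W : normedModType R) (f : R -> W) (l : W) (p : R -> R) (K : R) :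
  (forall t, 0 <= t -> `|l - f t| <= K * p t) -> p t @[t --> +oo] --> (0 : R) ->
  f t @[t --> +oo] --> l.
Proof.
move=> fK p0; apply/cvgrPdist_le => e e0.
have K1 : 0 < `|K| + 1 by rewrite ltr_wpDl.
move/cvgrPdist_le : p0 => /(_ (e / (`|K| + 1))); rewrite divr_gt0 // => /(_ isT) pe.
near=> t; have t0 : 0 <= t by near: t; apply: nbhs_pinfty_ge; exact: num_real.
apply: le_trans (fK t t0) _.
have : `|0 - p t| <= e / (`|K| + 1) by near: t; exact: pe.
rewrite sub0r normrN ler_pdivlMr // => /(le_trans _); apply.
apply: le_trans (ler_norm _) _; rewrite normrM mulrC ler_wpM2l // lerDl //.
Unshelve. all: by end_near. Qed.

Lemma potential_gt0 (M0 : R) (xi : V) : (0 < H)%N -> (forall j, 0 < m j) -> 0 < M0 ->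
  Sigma xi -> 0 < potential M0 m xi.
Proof.
move=> H0 hm M00 [x0 xx]; apply: ltr_pwDl.
  rewrite mulr_gt0 // (bigD1 (Ordinal H0)) //= ltr_pwDl //.
    by rewrite divr_gt0 // enorm_gt0.
  by apply: sumr_ge0 => j _; rewrite divr_ge0 ?sqrtr_ge0 // ltW.
do 2! apply: sumr_ge0 => ? _.
by rewrite divr_ge0 ?sqrtr_ge0 // mulr_ge0 // ltW.
Qed.

Lemma satisfies_equation_force (c : 'I_N -> R -> rV) (x : R -> V) :
  satisfies_equation m mt c x (fun t => force m mt (fun n => c n t) (x t)).
Proof.
move=> t _ j; rewrite row_force scalerBr scalerN !scaler_sumr.
by congr (- _ - _); apply: eq_bigr => i _; rewrite keplerE !scalerA; congr (_ *: _); ring.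
Qed.

End Scaling.

Section Motion.
Context {R : realType} {H k N : nat}.
Variables (m : 'I_H -> R) (mt : 'I_N -> R) (c : 'I_N -> R -> 'rV[R]_k).
Hypothesis hm : forall j, 0 < m j.
Hypothesis hc : forall i, continuous (c i).
Local Notation V := 'M[R]_(H, k).
Local Notation rV := 'rV[R]_k.
Variables (lam t0 U0 : R).
Hypotheses (lam_gt0 : 0 < lam) (t0_gt0 : 0 < t0) (U0_gt0 : 0 < U0).
Hypothesis lam_t0 : 2 * lam ^+ 3 = 9 * U0 * t0 ^+ 2.

(** The centres seen at logarithmic time s, in units of the homothetic motion;
    t0 (e^(3 s) - 1) is the physical time. *)
Definition rescaled_centers (s : R) (n : 'I_N) : rV :=
  (lam * expR (2 * s))^-1 *: c n (t0 * (expR (3 * s) - 1)).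

Lemma continuous_rescaled_centers n : continuous (fun s => rescaled_centers s n).
Proof.
move=> s; have ce a : {for s, continuous (fun t : R => expR (a * t))}.
  exact: is_derive_continuous (is_derive_expRM _ _).
apply: cvgZ.
  apply: cvgV; first by rewrite mulf_neq0 ?gt_eqF ?expR_gt0.
  by apply: cvgM; [exact: cvg_cst|exact: ce].
suff h : {for s, continuous (c n \o (fun t => t0 * (expR (3 * t) - 1)))} by exact: h.
apply: continuous_comp; last exact: hc.
by apply: cvgM; [exact: cvg_cst|apply: cvgB; [exact: ce|exact: cvg_cst]].
Qed.

Lemma rescaled_centers_le Xi s n : (forall t, `|c n t| <= Xi) ->
  `|rescaled_centers s n| <= Xi / lam * expR (- 2 * s).
Proof.
move=> cX; rewrite normrZ gtr0_norm ?invr_gt0 ?mulr_gt0 ?expR_gt0 //.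
by rewrite invfM mulNr expRN mulrC mulrA ler_wpM2r ?invr_ge0 ?expR_ge0 //
  ler_wpM2r // invr_ge0 ltW.
Qed.

Variables (xi : V) (h h1 h2 : R -> V) (eps C : R).
Hypothesis xi1 : mdot m xi xi = 1.
Hypothesis eps_le : eps <= 1 / 2.
Hypothesis dh : forall s, 0 <= s -> derive_coord h h1 s.
Hypothesis dh1 : forall s, 0 <= s -> derive_coord h1 h2 s.
Hypothesis ode : forall s, 0 <= s -> h2 s + h1 s =
  2 *: (xi + h s) + (2 / U0) *: force m mt (rescaled_centers s) (xi + h s).
Hypothesis h_le : forall s, 0 <= s -> mnorm m (h s) <= eps * expR (- (1 / 2) * s).
Hypothesis h1_le : forall s, 0 <= s -> forall j i,
  `|h1 s j i| <= C * expR (- (1 / 2) * s).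
Hypothesis ns : forall s, 0 <= s -> nonsingular (rescaled_centers s) (xi + h s).
Implicit Types t s : R.

Local Notation sg := (clock t0).

Definition dilation t : R := lam * expR (2 * sg t).
Definition profile t : V := xi + h (sg t).
Definition motion t : V := dilation t *: profile t.
Definition velocity t : V :=
  (lam / (3 * t0) * expR (- 1 * sg t)) *: (2 *: profile t + h1 (sg t)).

Lemma dilation_gt0 t : 0 < dilation t. Proof. by rewrite mulr_gt0 ?expR_gt0. Qed.

Lemma rescaled_centers_clock t n : 0 <= t ->
  c n t = dilation t *: rescaled_centers (sg t) n.
Proof.
move=> tt; rewrite /rescaled_centers expR_clock //; last first.
  by rewrite (lt_le_trans _ tt) // oppr_lt0.
rewrite scalerA mulfV ?gt_eqF ?dilation_gt0 // scale1r; congr (c n _).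
by field; rewrite gt_eqF.
Qed.

Definition acceleration t : V := force m mt (fun n => c n t) (motion t).

Lemma accelerationE t : 0 <= t -> acceleration t =
  (dilation t ^+ 2)^-1 *: force m mt (rescaled_centers (sg t)) (profile t).
Proof.
move=> tt.
have E : (fun n => c n t) = (fun n => dilation t *: rescaled_centers (sg t) n).
  by apply/funext => n; exact: rescaled_centers_clock.
rewrite /acceleration E; exact: forceZ (dilation_gt0 t).
Qed.

Lemma motion_nonsingular t : 0 <= t -> nonsingular (fun n => c n t) (motion t).
Proof.
move=> tt; have [n1 n2] := ns (clock_ge0 t0_gt0 tt).
have sn : dilation t != 0 by rewrite gt_eqF ?dilation_gt0.
split=> [j n|l j lj]; apply/eqP.
  rewrite (rescaled_centers_clock n tt) rowZ => /(scalerI sn); exact/eqP/n1.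
by rewrite !rowZ => /(scalerI sn); exact/eqP/n2.
Qed.

Lemma derive_clock_comp (f : R -> R) df t : 0 <= t -> is_derive (sg t) 1 f df ->
  is_derive t 1 (fun r => f (sg r)) (df * (expR (- 3 * sg t) / (3 * t0))).
Proof.
move=> tt d; have tp : - t0 < t by rewrite (lt_le_trans _ tt) // oppr_lt0.
exact: (@is_derive1_comp R f (clock t0) t _ _ d (is_derive_clock t0_gt0 tp)).
Qed.

Lemma derive_motion t : 0 <= t -> derive_coord motion velocity t.
Proof.
move=> tt j i; have s0 := clock_ge0 t0_gt0 tt.
have d := derive_clock_comp tt (is_derive_mulfun (is_derive_scalefun lam
  (is_derive_expRM 2 (sg t))) (is_derive_addfun (is_derive_cst (xi j i) _ _)
    (dh s0 j i))).
rewrite (_ : (fun t => _) =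
  (fun r => lam * expR (2 * sg r) * (cst (xi j i) (sg r) + h (sg r) j i))); last first.
  by apply/funext => r; rewrite !mxE.
apply: is_derive_eq d _; rewrite !mxE.
have -> : expR (- 1 * sg t) = expR (2 * sg t) * expR (- 3 * sg t).
  by rewrite -expRD; congr expR; ring.
by rewrite add0r /cst /=; field; rewrite gt_eqF.
Qed.

(** The equation for h enters here.  The relation between lam
    and t0 makes lam / (9 t0^2), the factor produced by the change of time, equal
    to (U0 / 2) lam^(-2), and homogeneity of the force accounts for lam^(-2). *)
Lemma derive_velocity t : 0 <= t -> derive_coord velocity acceleration t.
Proof.
move=> tt j i; have s0 := clock_ge0 t0_gt0 tt.
have d := derive_clock_comp tt (is_derive_mulfun (is_derive_scalefun (lam / (3 * t0))
  (is_derive_expRM (- 1) (sg t))) (is_derive_addfun (is_derive_scalefun 2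
   (is_derive_addfun (is_derive_cst (xi j i) _ _) (dh s0 j i))) (dh1 s0 j i))).
rewrite (_ : (fun t => _) = (fun r => lam / (3 * t0) * expR (- 1 * sg r) *
  (2 * (cst (xi j i) (sg r) + h (sg r) j i) + h1 (sg r) j i))); last first.
  by apply/funext => r; rewrite !mxE.
apply: is_derive_eq d _; rewrite accelerationE // /dilation.
have := congr1 (fun M : V => M j i) (ode s0); rewrite /profile !mxE.
move: (force _ _ _ _ j i) => f E.
have {E} -> : h2 (sg t) j i = 2 * (xi j i + h (sg t) j i) + 2 / U0 * f - h1 (sg t) j i.
  by rewrite -E addrK.
have -> : (lam * expR (2 * sg t)) ^+ 2 =
    lam ^+ 2 / (expR (- 1 * sg t) * expR (- 3 * sg t)).
  rewrite exprMn; congr (_ * _); rewrite -expRD -expRN expr2 -expRD.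
  by congr expR; ring.
have e1 : expR (- 1 * sg t) != 0 by rewrite gt_eqF ?expR_gt0.
have e3 : expR (- 3 * sg t) != 0 by rewrite gt_eqF ?expR_gt0.
have ln0 : lam != 0 by rewrite gt_eqF.
have Un : U0 != 0 by rewrite gt_eqF.
have tn : t0 != 0 by rewrite gt_eqF.
have lam2 : lam / (9 * t0 ^+ 2) * (2 / U0) = (lam ^+ 2)^-1.
  have -> : lam / (9 * t0 ^+ 2) * (2 / U0) = 2 * lam ^+ 3 / (9 * U0 * t0 ^+ 2) / lam ^+ 2.
    by field; rewrite ln0 Un tn.
  by rewrite lam_t0 mulfV ?mul1r // !mulf_neq0 ?expf_neq0 // pnatr_eq0.
rewrite [in RHS]invfM -lam2 add0r invrK /cst /=; field.
by rewrite Un tn.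
Qed.

Lemma motion_C2 : halfline_C2 motion velocity acceleration.
Proof.
split; [exact: halfline_derivative_coord derive_motion|
        exact: halfline_derivative_coord derive_velocity|].
apply: continuous_in_subspaceT => t; rewrite inE /= in_itv /= andbT => tt.
have cm : {for t, continuous motion}.
  by apply/continuous_at_mx => j i; exact: is_derive_continuous (derive_motion tt j i).
have [n1 n2] := motion_nonsingular tt.
by apply: (continuous_at_force (b := fun t n => c n t) cm) => // n; exact: hc.
Qed.

Lemma decay_cvg0 : expR (- (1 / 2) * sg t) @[t --> +oo] --> (0 : R).
Proof. by apply: clock_decay => //; rewrite divr_gt0. Qed.

Lemma decay_le1 t : 0 <= t -> expR (- (1 / 2) * sg t) <= 1.
Proof.
move=> tt; rewrite expR_le1 mulNr oppr_le0 mulr_ge0 ?divr_ge0 //; exact: clock_ge0.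
Qed.

Lemma mnorm_xi : mnorm m xi = 1. Proof. by rewrite /mnorm xi1 sqrtr1. Qed.

Lemma mnorm_profile_dist t : 0 <= t ->
  `|1 - mnorm m (profile t)| <= eps * expR (- (1 / 2) * sg t).
Proof.
move=> tt; have hle := h_le (clock_ge0 t0_gt0 tt); apply: le_trans hle.
have h3 : mnorm m (profile t) <= 1 + mnorm m (h (sg t)) by rewrite -mnorm_xi mnormD.
have h4 : 1 <= mnorm m (profile t) + mnorm m (h (sg t)).
  have := mnormD hm (profile t) (- h (sg t)).
  by rewrite /profile addrK mnormN mnorm_xi.
by rewrite ler_norml; apply/andP; split; lra.
Qed.

Lemma mnorm_profile_cvg : mnorm m (profile t) @[t --> +oo] --> (1 : R).
Proof. exact: cvg_dominated mnorm_profile_dist decay_cvg0. Qed.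

Lemma mnorm_profile_bounds t : 0 <= t -> 1 / 2 <= mnorm m (profile t) <= 2.
Proof.
move=> tt; have := mnorm_profile_dist tt; have := decay_le1 tt.
have := expR_ge0 (- (1 / 2) * sg t); move: (expR _) => p p0 p1.
have ep : eps * p <= 1 / 2 * p by rewrite ler_wpM2r.
by rewrite ler_norml => /andP[l1 l2]; apply/andP; split; lra.
Qed.

Lemma profile_cvg : profile t @[t --> +oo] --> xi.
Proof.
have [C2 C20 hC2] := norm_le_mnorm (k := k) hm.
apply: (@cvg_dominated _ _ _ _ _ (C2 * eps)) decay_cvg0 => t tt.
rewrite /profile opprD addrA subrr sub0r normrN (le_trans (hC2 _)) // -mulrA ler_pM2l //.
exact: h_le (clock_ge0 t0_gt0 tt).
Qed.

Lemma mnorm_motion t : mnorm m (motion t) = dilation t * mnorm m (profile t).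
Proof. by rewrite mnormZ gtr0_norm ?dilation_gt0. Qed.

Lemma direction_cvg : (mnorm m (motion t))^-1 *: motion t @[t --> +oo] --> xi.
Proof.
have E t : (mnorm m (motion t))^-1 *: motion t = (mnorm m (profile t))^-1 *: profile t.
  rewrite mnorm_motion /motion scalerA invfM -mulrA mulrCA mulVf ?mulr1 //.
  by rewrite gt_eqF ?dilation_gt0.
under eq_fun do rewrite E; rewrite -[xi]scale1r -[1]invr1.
apply: cvgZ; last exact: profile_cvg.
by apply: cvgV; [exact: oner_neq0|exact: mnorm_profile_cvg].
Qed.

Lemma mnorm_motion_cvg : mnorm m (motion t) @[t --> +oo] --> +oo.
Proof.
apply/cvgryPge => A; near=> t.
have tt : 0 <= t by near: t; apply: nbhs_pinfty_ge; exact: num_real.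
have At : A / lam <= sg t.
  by near: t; have /cvgryPge /(_ (A / lam)) := clock_cvgy t0_gt0.
have s0 := clock_ge0 t0_gt0 tt; have /andP[y2 _] := mnorm_profile_bounds tt.
have e2 := expR_ge1Dx (2 * sg t).
rewrite ler_pdivrMr // in At; rewrite mnorm_motion /dilation.
have h3 : lam * (1 + 2 * sg t) <= lam * expR (2 * sg t) by rewrite ler_pM2l.
have h4 : lam * expR (2 * sg t) * (1 / 2) <= lam * expR (2 * sg t) * mnorm m (profile t).
  by rewrite ler_wpM2l // mulr_ge0 ?expR_ge0 // ltW.
move: h3 h4 At lam_gt0; lra.
Unshelve. all: by end_near. Qed.

Lemma velocity_cvg0 : velocity t @[t --> +oo] --> (0 : V).
Proof.
have [C2 C20 hC2] := norm_le_mnorm (k := k) hm.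
pose K := lam / (3 * t0) * (2 * (C2 * 2) + `|C|).
apply: (@cvg_dominated _ _ _ _ _ K) decay_cvg0 => t tt.
have s0 := clock_ge0 t0_gt0 tt.
have p1 := decay_le1 tt.
have c0 : 0 < lam / (3 * t0) by rewrite divr_gt0 ?mulr_gt0.
rewrite sub0r normrN normrZ gtr0_norm ?(mulr_gt0 c0) ?expR_gt0 // /K.
move: (lam / (3 * t0)) c0 => a a0; rewrite -!mulrA ler_pM2l // mulrC.
apply: ler_pM => //.
  rewrite (le_trans (ler_normD _ _)) // lerD //.
    rewrite normrZ ger0_norm // ler_pM2l // (le_trans (hC2 _)) // ler_pM2l //.
    by have /andP[] := mnorm_profile_bounds tt.
  apply: norm_le_coord => // j i; rewrite (le_trans (h1_le s0 j i)) //.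
  rewrite (@le_trans _ _ (`|C| * expR (- (1 / 2) * sg t))) ?ler_piMr //.
  by rewrite ler_wpM2r ?expR_ge0 // ler_norm.
by rewrite ler_expR; move: s0; lra.
Qed.

(** The choice of t0 gives lam e^(2 s) = omega (t + t0)^(2/3), so the quotient is
    |xi + h| ((t + t0) / t)^(2/3). *)
Lemma motion_asymp : asymp_equiv (fun t => mnorm m (motion t))
  (fun t => ((9 * U0 / 2) `^ (1 / 3)) * t `^ (2 / 3)).
Proof.
have U9 : 0 < 9 * U0 / 2 by rewrite divr_gt0 // mulr_gt0.
have llam : 3 * ln lam = ln (9 * U0 / 2) + 2 * ln t0.
  have E : lam ^+ 3 = 9 * U0 / 2 * t0 ^+ 2.
    by apply: (@mulfI _ 2) => //; rewrite lam_t0; field.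
  have := congr1 (@ln R) E; rewrite lnM ?posrE ?exprn_gt0 // !lnXn //.
  by rewrite -(mulr_natl (ln lam)) -(mulr_natl (ln t0)).
have ratio t : 0 < t -> mnorm m (motion t) / ((9 * U0 / 2) `^ (1 / 3) * t `^ (2 / 3)) =
    mnorm m (profile t) * expR (2 / 3 * ln (1 + t0 / t)).
  move=> tt; rewrite mnorm_motion /dilation /powR !gt_eqF //.
  rewrite -{1}[lam]lnK ?posrE // -!expRD mulrC mulrA -expRN -expRD mulrC; congr (_ * expR _).
  have -> : 1 + t0 / t = (t + t0) / t by field; rewrite gt_eqF.
  have tp : 0 < t + t0 by rewrite addr_gt0.
  rewrite /clock; move: (ln (9 * U0 / 2)) llam => w llam.
  by rewrite !ln_div ?posrE //; lra.
suff lim : mnorm m (profile t) * expR (2 / 3 * ln (1 + t0 / t)) @[t --> +oo]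
    --> (1 * expR 0 : R).
  rewrite expR0 mul1r in lim; apply: cvg_trans lim; apply: near_eq_cvg; near=> t.
  by rewrite ratio //; near: t; apply: nbhs_pinfty_gt; exact: num_real.
apply: cvgM; first exact: mnorm_profile_cvg.
suff l0 : 2 / 3 * ln (1 + t0 / t) @[t --> +oo] --> (0 : R).
  by apply: cvg_comp l0 _; exact: continuous_expR.
apply/cvgrPdist_le => e e0; near=> t.
have te : t0 / e <= t by near: t; apply: nbhs_pinfty_ge; exact: num_real.
have tt : 0 < t by near: t; apply: nbhs_pinfty_gt; exact: num_real.
have q0 : 0 <= t0 / t by rewrite divr_ge0 // ltW.
have qe : t0 / t <= e.
  by rewrite ler_pdivrMr // mulrC -ler_pdivrMr.
have l0 : 0 <= ln (1 + t0 / t) by rewrite ln_ge0 // lerDl.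
have l1 : ln (1 + t0 / t) <= t0 / t by apply: le_ln1Dx; rewrite (lt_le_trans _ q0).
rewrite sub0r normrN ger0_norm ?mulr_ge0 ?divr_ge0 //; lra.
Unshelve. all: by end_near. Qed.

Lemma motion_parabolic : parabolic_solution m mt c motion.
Proof.
exists velocity, acceleration; split.
- exact: motion_C2.
- by move=> t tt; exact: motion_nonsingular.
- exact: satisfies_equation_force.
- exact: mnorm_motion_cvg.
- exact: velocity_cvg0.
Qed.

End Motion.

(** * Parabolic solutions asymptotic to a central configuration *)

Unset Implicit Arguments.

Theorem corollary6p2 (R : realType) (H N k : nat)
  (hH : (2 <= H)%N) (hN : (2 <= N)%N) (hk : (2 <= k)%N)
  (m : 'I_H -> R) (hm : forall j, 0 < m j)
  (mt : 'I_N -> R) (hmt : forall i, 0 < mt i)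
  (c : 'I_N -> R -> 'rV[R]_k) (hc : forall i, continuous (c i))
  (Xi : R) (hXi : 0 < Xi)
  (hcXi : forall i,
     (ereal_sup (range (fun t : R => (enorm (c i t))%:E)) < Xi%:E)%E)
  (xi : 'M[R]_(H, k)) (hxi : central_configuration (\sum_i mt i) m xi)
  (nu1 : R)
  (hnu1 : smallest_hess_eigenvalue m (potential (\sum_i mt i) m) xi nu1)
  (hBS : - (1 / 8) * potential (\sum_i mt i) m xi < nu1)
  (eta : R) (heta0 : 0 < eta) (heta1 : eta < 1)
  (hcone : forall x : 'M[R]_(H, k),
     x != 0 -> eta * mnorm m x <= mdot m x xi -> Sigma x) :
  exists rho eta' : R,
    [/\ Xi + 1 < rho, eta <= eta', eta' < 1 &
      forall x0 : 'M[R]_(H, k), cone m xi rho eta' x0 ->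
      exists x : R -> 'M[R]_(H, k),
        [/\ parabolic_solution m mt c x,
            x 0 = x0,
            (mnorm m (x t))^-1 *: x t @[t --> +oo] --> xi &
            asymp_equiv (fun t => mnorm m (x t))
              (fun t => ((9 * potential (\sum_i mt i) m xi / 2) `^ (1 / 3))
                        * t `^ (2 / 3))]].
Proof.
have [x1 xS _] := hxi.
have M0 : 0 < \sum_i mt i.
  rewrite (bigD1 (Ordinal (ltnW hN))) //= ltr_pwDl // sumr_ge0 // => i _; exact: ltW.
have U0 := potential_gt0 (ltnW hH) hm M0 xS.
have [eps [beta0 [eps0 eps1 beta00 sol]]] := logarithmic_time_solution hm hxi hnu1 U0 hBS.
have xx := mdot_central hm hxi.
have cXi n t : `|c n t| <= Xi.
  rewrite (le_trans (norm_le_enorm _)) // -lee_fin.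
  apply: le_trans (ltW (hcXi n)); apply: ereal_sup_ubound; by exists t.
(* |x0 / lam - xi|^2 = 2 - 2 <x0 / lam, xi>, hence 1 - eps^2 / 2; the term
   Xi / beta0 makes the rescaled centres smaller than beta0. *)
exists (Xi + 2 + Xi / beta0), (Num.max eta (1 - eps ^+ 2 / 2)); split.
- by have := divr_gt0 hXi beta00; lra.
- by rewrite le_max lexx.
- rewrite gt_max heta1 /= gtrBl divr_gt0 // exprn_gt0 //.
move=> x0 [lam_gt cone_x0].
set lam := mnorm m x0 in lam_gt cone_x0.
have lam0 : 0 < lam.
  by apply: lt_trans lam_gt; rewrite !addr_gt0 // divr_gt0.
pose h0 := lam^-1 *: x0 - xi.
have h0_eps : mnorm m h0 <= eps.
  apply: mnorm_le => //; first exact: ltW.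
  have n1 : mdot m (lam^-1 *: x0) (lam^-1 *: x0) = 1.
    by rewrite mdotZl mdotZr -sqr_mnorm // -/lam; field; rewrite gt_eqF.
  move: cone_x0; rewrite gt_max => /andP[_ h].
  by rewrite mdotBl !mdotBr n1 xx (mdotC m xi); lra.
pose t0 := Num.sqrt (2 * lam ^+ 3 / (9 * potential (\sum_i mt i) m xi)).
have q0 : 0 < 2 * lam ^+ 3 / (9 * potential (\sum_i mt i) m xi).
  by rewrite divr_gt0 ?mulr_gt0 // exprn_gt0.
have t00 : 0 < t0 by rewrite sqrtr_gt0.
have lam_t0 : 2 * lam ^+ 3 = 9 * potential (\sum_i mt i) m xi * t0 ^+ 2.
  by rewrite sqr_sqrtr ?(ltW q0) //; field; rewrite gt_eqF.
have beta_ge0 : 0 <= Xi / lam by rewrite divr_ge0 // ltW.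
have beta_le : Xi / lam <= beta0.
  rewrite ler_pdivrMr // mulrC -ler_pdivrMr //.
  by apply: ltW; apply: le_lt_trans lam_gt; rewrite lerDr addr_ge0 // ltW.
have [h [h1 [h2 [C [h00 dh dh1 hP]]]]] := sol (rescaled_centers c lam t0) _
  (continuous_rescaled_centers hc lam0 (t0 := t0)) beta_ge0 beta_le
  (fun s n _ => rescaled_centers_le t0 lam0 s (cXi n)) h0 h0_eps.
have ode s (hs : 0 <= s) := let: And4 e _ _ _ := hP s hs in e.
have h_le s (hs : 0 <= s) := let: And4 _ e _ _ := hP s hs in e.
have h1_le s (hs : 0 <= s) := let: And4 _ _ e _ := hP s hs in e.
have ns s (hs : 0 <= s) := let: And4 _ _ _ e := hP s hs in e.
exists (motion lam t0 xi h); split.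
- exact: (motion_parabolic hm hc lam0 t00 U0 lam_t0 xx eps1 dh dh1 ode h_le h1_le ns).
- rewrite /motion /dilation /profile clock0 // mulr0 expR0 mulr1 h00 /h0.
  by rewrite addrC subrK scalerA mulfV ?scale1r // gt_eqF.
- exact: (direction_cvg hm lam0 t00 xx h_le).
- exact: (motion_asymp hm lam0 t00 U0 lam_t0 xx h_le).
Qed.
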